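(* The lattice of subvarieties of the monoid variety $\mathbb{L}_2^1\vee\mathbb{Q}^1$ consists of exactly the following twelve pairwise distinct varieties: \[\mathbf{0},\ \mathbb{M}\varnothing,\ \mathbb{M}\{x\},\ \mathbb{M}\{xy\},\ \mathbb{I}^1,\ \mathbb{J}^1,\ \mathbb{B}_0^1,\ \mathbb{Q}^1,\ \mathbb{L}_2^1,\ \mathbb{L}_2^1\vee\mathbb{M}\{x\},\ \mathbb{L}_2^1\vee\mathbb{B}_0^1,\ \mathbb{L}_2^1\vee\mathbb{Q}^1,\] and its covering relations are exactly: $\mathbb{M}\varnothing$ covers $\mathbf{0}$; $\mathbb{M}\{x\}$ covers $\mathbb{M}\varnothing$; $\mathbb{M}\{xy\}$ covers $\mathbb{M}\{x\}$; $\mathbb{I}^1$ and $\mathbb{J}^1$ each cover $\mathbb{M}\{xy\}$; $\mathbb{B}_0^1$ covers $\mathbb{I}^1$ and $\mathbb{J}^1$; $\mathbb{Q}^1$ covers $\mathbb{B}_0^1$; $\mathbb{L}_2^1$ covers $\mathbb{M}\varnothing$; $\mathbb{L}_2^1\vee\mathbb{M}\{x\}$ covers $\mathbb{L}_2^1$ and $\mathbb{I}^1$; $\mathbb{L}_2^1\vee\mathbb{B}_0^1$ covers $\mathbb{L}_2^1\vee\mathbb{M}\{x\}$ and $\mathbb{B}_0^1$; $\mathbb{L}_2^1\vee\mathbb{Q}^1$ covers $\mathbb{L}_2^1\vee\mathbb{B}_0^1$ and $\mathbb{Q}^1$.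
   Context: Monoids are algebras in the signature $\{\cdot,1\}$; a monoid variety is a class of monoids defined by a set of identities; $\vee$ denotes the join of monoid varieties; $\mathbf{0}$ is the trivial variety. For a semigroup $S$ without identity, $S^1=S\cup\{1\}$ is the monoid obtained by adjoining an identity. $\mathbb{L}_2^1,\mathbb{Q}^1,\mathbb{B}_0^1,\mathbb{I}^1,\mathbb{J}^1$ are the monoid varieties generated by $L_2^1,Q^1,B_0^1,I^1,J^1$ respectively, where (with $0$ denoting a zero element) $L_2=\langle a,b\mid a^2=ab=a,\ b^2=ba=b\rangle$, $Q=\langle a,b,c\mid a^2=a,\ ab=b,\ ca=c,\ ac=ba=cb=0\rangle$, $B_0=\langle a,b,c\mid a^2=a,\ b^2=b,\ ab=ba=0,\ ac=cb=c\rangle$, $I=\langle a,b\mid ab=a,\ ba=0,\ b^2=b\rangle$, $J=\langle a,b\mid ba=a,\ ab=0,\ b^2=b\rangle$. For a set $W$ of words, $\mathsf{M}W$ is the monoid consisting of all factors of words in $W$ together with the empty word $1$ and a zero $0$, with $\mathbf{u}\cdot\mathbf{v}=\mathbf{u}\mathbf{v}$ if $\mathbf{u}\mathbf{v}$ belongs to the set of these factors and $0$ otherwise; $\mathsf{M}\varnothing=\{0,1\}$ is the semilattice of order two. $\mathbb{M}W$ is the monoid variety generated by $\mathsf{M}W$. Here $x,y$ are distinct variables. *)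

(* Defs.v *)
From HB Require Import structures.
From mathcomp Require Import all_boot.
From mathcomp Require Import generic_quotient boolp classical_sets.

Set Implicit Arguments.
Unset Strict Implicit.
Unset Printing Implicit Defensive.

Local Open Scope classical_set_scope.
Local Open Scope quotient_scope.
Local Open Scope group_scope.

(* Words over the countably infinite alphabet of variables [nat]. *)
Definition word := seq nat.
Definition identity := (word * word)%type.

Definition eval (M : monoidType) (f : nat -> M) (w : word) : M :=
  \prod_(i <- w) f i.

Definition satisfies (M : monoidType) (e : identity) : Prop :=
  forall f : nat -> M, eval f e.1 = eval f e.2.

(* Classes of monoids are predicates on [monoidType]; the [set] of
   classical_sets cannot be used for them, for universe reasons. *)
Definition monoid_class := monoidType -> Prop.

Definition sub_class (V W : monoid_class) : Prop := forall M, V M -> W M.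
Definition proper_sub_class (V W : monoid_class) : Prop :=
  sub_class V W /\ ~ sub_class W V.

Definition models (E : set identity) : monoid_class :=
  fun M => forall e, E e -> satisfies M e.

Definition is_variety (V : monoid_class) : Prop := exists E, V = models E.

(* The least variety containing the class [K]. *)
Definition generated (K : monoid_class) : monoid_class :=
  fun M => forall V, is_variety V -> sub_class K V -> V M.

Definition var (M : monoidType) : monoid_class := generated (fun N => N = M).

Definition join (V W : monoid_class) : monoid_class :=
  generated (fun M => V M \/ W M).

Definition trivial_variety : monoid_class := fun M => forall a : M, a = 1.

Definition subvariety (X V : monoid_class) : Prop :=
  is_variety V /\ sub_class V X.

(* [W] covers [V] in the lattice of subvarieties of [X]. *)
Definition covers (X W V : monoid_class) : Prop :=
  [/\ subvariety X V, subvariety X W, proper_sub_class V W &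
      forall U, subvariety X U ->
        ~ (proper_sub_class V U /\ proper_sub_class U W)].

(* [None] is the new identity, adjoined whether or not [S] already has one. *)
Definition adjoin1 (S : semigroupType) := option S.

Section Adjoin1.
Variable S : semigroupType.

HB.instance Definition _ := Choice.on (adjoin1 S).

Definition mul1 (x y : adjoin1 S) : adjoin1 S :=
  match x, y with
  | None, _ => y
  | _, None => x
  | Some s, Some t => Some (s * t)
  end.

Fact mul1A : associative mul1.
Proof. by case=> [x|] [y|] [z|] //=; rewrite mulgA. Qed.

Fact mul11x : left_id (None : adjoin1 S) mul1.
Proof. by case. Qed.

Fact mul1x1 : right_id (None : adjoin1 S) mul1.
Proof. by case. Qed.

HB.instance Definition _ := isMonoid.Build (adjoin1 S) mul1A mul11x mul1x1.
End Adjoin1.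

(* The free semigroup: [(x, s)] stands for the nonempty word [x :: s]. *)
Definition free_semigroup (A : choiceType) := (A * seq A)%type.

Section FreeSemigroup.
Variable A : choiceType.

HB.instance Definition _ := Choice.on (free_semigroup A).

Definition free_mul (u v : free_semigroup A) : free_semigroup A :=
  (u.1, u.2 ++ v.1 :: v.2).

Fact free_mulA : associative free_mul.
Proof. by move=> [x s] [y t] [z r]; rewrite /free_mul /= -catA. Qed.

HB.instance Definition _ := isSemigroup.Build (free_semigroup A) free_mulA.

Definition gen (x : A) : free_semigroup A := (x, [::]).
End FreeSemigroup.

Section Presentation.
Variables (A : choiceType).
Variable R : seq (free_semigroup A * free_semigroup A).

Inductive congruence : free_semigroup A -> free_semigroup A -> Prop :=
| congr_rel u v : (u, v) \in R -> congruence u v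
| congr_refl u : congruence u u
| congr_sym u v : congruence u v -> congruence v u
| congr_trans v u w : congruence u v -> congruence v w -> congruence u w
| congr_mul u u' v v' :
    congruence u u' -> congruence v v' -> congruence (u * v) (u' * v').

Definition congruenceb : rel (free_semigroup A) :=
  fun u v => `[< congruence u v >].

Fact congruenceb_refl : reflexive congruenceb.
Proof. by move=> u; apply/asboolP/congr_refl. Qed.

Fact congruenceb_sym : symmetric congruenceb.
Proof. by move=> u v; apply/asboolP/asboolP; apply: congr_sym. Qed.

Fact congruenceb_trans : transitive congruenceb.
Proof.
by move=> v u w /asboolP uv /asboolP vw; apply/asboolP/(congr_trans uv).
Qed.

Canonical congruence_equiv :=
  EquivRel congruenceb congruenceb_refl congruenceb_sym congruenceb_trans.

Definition presented := {eq_quot congruenceb}.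

HB.instance Definition _ := Choice.on presented.
HB.instance Definition _ := EqQuotient.on presented.

Definition pres_mul (x y : presented) : presented :=
  \pi_presented (repr x * repr y).

Fact congruence_repr u : congruence (repr (\pi_presented u)) u.
Proof.
apply/asboolP; rewrite -[`[< _ >]]/(congruence_equiv _ _).
by apply/(eqmodP congruence_equiv); rewrite reprK.
Qed.

Fact pres_mul_pi u v :
  pres_mul (\pi_presented u) (\pi_presented v) = \pi_presented (u * v).
Proof.
apply/(eqmodP congruence_equiv); apply/asboolP.
by apply: congr_mul; apply: congruence_repr.
Qed.

Fact pres_mulA : associative pres_mul.
Proof.
move=> x y z; rewrite -[x]reprK -[y]reprK -[z]reprK.
move: (repr x) (repr y) (repr z) => u v w.
rewrite (pres_mul_pi v w) (pres_mul_pi u v).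
by rewrite (pres_mul_pi u (v * w)) (pres_mul_pi (u * v) w) mulgA.
Qed.

HB.instance Definition _ := isSemigroup.Build presented pres_mulA.
End Presentation.

(* Presentations of semigroups with zero: [None] is the extra generator 0. *)
Definition zero_rels (n : nat) :
    seq (free_semigroup (option 'I_n) * free_semigroup (option 'I_n)) :=
  [seq (gen None * gen x, gen None) | x : option 'I_n] ++
  [seq (gen x * gen None, gen None) | x : option 'I_n].

Definition presented0 (n : nat)
    (R : seq (free_semigroup (option 'I_n) * free_semigroup (option 'I_n))) :=
  presented (R ++ zero_rels n).

HB.instance Definition _ n R := Semigroup.on (@presented0 n R).

Definition L2_rels :=
  let a := gen (ord0 : 'I_2) in
  let b := gen (ord_max : 'I_2) in
  [:: (a * a, a); (a * b, a); (b * b, b); (b * a, b)].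

Definition Q_rels :=
  let zero := gen None in
  let a := gen (Some (@Ordinal 3 0 isT)) in
  let b := gen (Some (@Ordinal 3 1 isT)) in
  let c := gen (Some (@Ordinal 3 2 isT)) in
  [:: (a * a, a); (a * b, b); (c * a, c);
      (a * c, zero); (b * a, zero); (c * b, zero)].

Definition B0_rels :=
  let zero := gen None in
  let a := gen (Some (@Ordinal 3 0 isT)) in
  let b := gen (Some (@Ordinal 3 1 isT)) in
  let c := gen (Some (@Ordinal 3 2 isT)) in
  [:: (a * a, a); (b * b, b); (a * b, zero); (b * a, zero);
      (a * c, c); (c * b, c)].

Definition I_rels :=
  let zero := gen None in
  let a := gen (Some (ord0 : 'I_2)) in
  let b := gen (Some (ord_max : 'I_2)) in
  [:: (a * b, a); (b * a, zero); (b * b, b)].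

Definition J_rels :=
  let zero := gen None in
  let a := gen (Some (ord0 : 'I_2)) in
  let b := gen (Some (ord_max : 'I_2)) in
  [:: (b * a, a); (a * b, zero); (b * b, b)].

Definition VL2 := var (adjoin1 (presented L2_rels)).
Definition VQ := var (adjoin1 (presented0 Q_rels)).
Definition VB0 := var (adjoin1 (presented0 B0_rels)).
Definition VI := var (adjoin1 (presented0 I_rels)).
Definition VJ := var (adjoin1 (presented0 J_rels)).

Section FactorMonoid.
Variable W : set word.

Definition factor_of (w : word) : bool :=
  `[< w = [::] \/ exists2 u, W u & infix w u >].

Fact factor_of_nil : factor_of [::].
Proof. by apply/asboolP; left. Qed.

Fact factor_of_infix u v : infix u v -> factor_of v -> factor_of u.
Proof.
move=> uv /asboolP[v0|[w Ww vw]]; apply/asboolP.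
  by left; move: uv; rewrite v0 infixs0 => /eqP.
by right; exists w => //; apply: infix_trans uv vw.
Qed.

(* [None] is the zero. *)
Definition factor_monoid := option {w : word | factor_of w}.

HB.instance Definition _ := Choice.on factor_monoid.

(* [insub] is [None] on words that are not factors. *)
Definition factor_mul (x y : factor_monoid) : factor_monoid :=
  match x, y with
  | Some u, Some v => insub (val u ++ val v)
  | _, _ => None
  end.

Definition factor_one : factor_monoid := Some (exist _ [::] factor_of_nil).

Fact factor_mulA : associative factor_mul.
Proof.
move=> [u|] [v|] [w|] //=; last by case: insub.
case: (insubP _ (val v ++ val w)) => [vw _ /= ->|nvw] /=;
  case: (insubP _ (val u ++ val v)) => [uv _ /= ->|nuv] /=.
- by rewrite catA.
- rewrite insubN //; apply: contra nuv; apply: factor_of_infix.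
  by rewrite catA prefixW ?prefix_prefix.
- rewrite insubN //; apply: contra nvw; apply: factor_of_infix.
  by rewrite -catA suffixW ?suffix_suffix.
- by [].
Qed.

Fact factor_mul1x : left_id factor_one factor_mul.
Proof. by case=> [u|] //=; rewrite valK. Qed.

Fact factor_mulx1 : right_id factor_one factor_mul.
Proof. by case=> [u|] //=; rewrite cats0 valK. Qed.

HB.instance Definition _ :=
  isMonoid.Build factor_monoid factor_mulA factor_mul1x factor_mulx1.
End FactorMonoid.

Definition VM (W : set word) := var (factor_monoid W).

(* Main.v *)
(* A subvariety of L_2^1 v Q^1 is determined by its equational theory, a fully
   invariant congruence on words. Modulo the identities of L_2^1 v Q^1, every
   identity u = v is equivalent to some of the seven identities x = 1, x = xx,
   xy = yx, xyx = yxx, xyx = xxy, xyxzx = xyzx and xxyy = yyxx. When u and v have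
   the same letters and the same simple letters in the same order, the last four
   record the possible differences: whether a letter occurs before a simple
   letter t, after t, or between two simple letters, and the order of first
   occurrences. A subvariety is therefore determined by which of the seven
   identities it satisfies; only twelve patterns are consistent, and the twelve
   named varieties realize them. Inclusion, hence covering, is read off from the
   patterns. *)
From HB Require Import structures.
Require Import Defs.
From Stdlib Require List.
From mathcomp Require Import all_boot.
From mathcomp Require Import generic_quotient boolp classical_sets.

Set Implicit Arguments.
Unset Strict Implicit.
Unset Printing Implicit Defensive.

(** * Fully invariant congruences on words *)

(** No equational basis of any named variety is computed. The test identities attached to u = v are
    read off from the two words alone, so one list serves every theory under consideration. To show
    that a theory containing u = v contains its list, a substitution erases all but at most three
    letters, which leaves a test identity up to powers. For the converse the two words are repaired
    until they agree, and the obstacle is that a repair must not destroy agreements already reached.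
    Prepending or appending non-simple letters leaves the gaps between simple letters alone.
    Deleting middle occurrences does change the gaps, but once no letter occurs more than twice, a
    gap is determined by what lies before and after its two ends. Identities with equal content but
    different simple letters lie outside this scheme: they force x = xx, after which the order of
    first occurrences is all that matters. *)

Definition substw (h : nat -> word) (w : word) : word := flatten (map h w).

Record fully_invariant (E : word -> word -> Prop) := FullyInvariant {
  fi_refl : forall u, E u u;
  fi_sym : forall u v, E u v -> E v u;
  fi_trans : forall v u w, E u v -> E v w -> E u w;
  fi_cat : forall u u' v v', E u u' -> E v v' -> E (u ++ v) (u' ++ v');
  fi_subst : forall h u v, E u v -> E (substw h u) (substw h v) }.

Lemma substw_cat h u v : substw h (u ++ v) = substw h u ++ substw h v.
Proof. by rewrite /substw map_cat flatten_cat. Qed.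

Lemma substw_cons h x u : substw h (x :: u) = h x ++ substw h u.
Proof. by []. Qed.

(* If [t] does not occur in [w], [before t w] is [w] and [after t w] is empty. *)
Definition before (t : nat) (w : word) : word := take (index t w) w.
Definition after (t : nat) (w : word) : word := drop (index t w).+1 w.

Definition first_of (w : word) (x y : nat) := ohead (filter (pred2 x y) w).

Definition same_first (u v : word) :=
  forall x y, first_of u x y = first_of v x y.

(* [S] is the set of non-simple letters: the letters outside [S] cut both words
   into blocks, and corresponding blocks have the same content. *)
Record same_blocks (S : pred nat) (u v : word) : Prop := SameBlocks {
  sb_content : u =i v;
  sb_countl : forall t, ~~ S t -> count_mem t u <= 1;
  sb_countr : forall t, ~~ S t -> count_mem t v <= 1;
  sb_before : forall t, ~~ S t -> before t u =i before t v;
  sb_after : forall t, ~~ S t -> after t u =i after t v;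
  sb_between : forall s t, ~~ S s -> ~~ S t ->
    before t (after s u) =i before t (after s v) }.

Lemma before_cat t p q : t \notin p -> before t (p ++ t :: q) = p.
Proof.
by move=> tp; rewrite /before index_cat (negbTE tp) /= eqxx addn0 take_size_cat.
Qed.

Lemma after_cat t p q : t \notin p -> after t (p ++ t :: q) = q.
Proof.
move=> tp; rewrite /after index_cat (negbTE tp) /= eqxx addn0.
by rewrite -cat_rcons drop_size_cat // size_rcons.
Qed.

Lemma before_notin t w : t \notin w -> before t w = w.
Proof. by move=> tw; rewrite /before memNindex // take_size. Qed.

Lemma after_notin t w : t \notin w -> after t w = [::].
Proof. by move=> tw; rewrite /after memNindex // drop_oversize. Qed.

Lemma split_all (S : pred nat) (w : word) : ~~ all S w ->
  exists p t q, [/\ w = p ++ t :: q, all S p & ~~ S t].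
Proof.
elim: w => //= x w IH; have [Sx /= /IH|Sx _] := boolP (S x).
  by move=> [p [t [q [-> Sp St]]]]; exists (x :: p), t, q; rewrite /= Sx.
by exists [::], x, w.
Qed.

Lemma split_before t (w : word) :
  t \in w -> w = before t w ++ t :: after t w.
Proof.
move=> tw; rewrite -{1}(cat_take_drop (index t w) w); congr (_ ++ _).
by rewrite (drop_nth 0) ?index_mem // nth_index.
Qed.

Lemma before_self t w : t \notin before t w.
Proof. by apply/negP => /index_ltn; rewrite ltnn. Qed.

Lemma count1_split t (w : word) : t \in w -> count_mem t w <= 1 ->
  [/\ w = before t w ++ t :: after t w, t \notin before t w & t \notin after t w].
Proof.
move=> tw; rewrite {1}(split_before tw) count_cat /= eqxx => c.
split; [exact: split_before | exact: before_self |].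
apply/count_memPn; case: (count_mem t (after t w)) c => // n.
by rewrite !addnS.
Qed.

Ltac norm_word :=
  rewrite /substw /= ?cats0 -?catA /= -?catA /= -?catA /= -?catA /=.

Section Congruence.
Variable E : word -> word -> Prop.
Hypothesis fE : fully_invariant E.
Local Notation "u ~ v" := (E u v) (at level 70).

Lemma Erefl u : u ~ u. Proof. exact: fi_refl. Qed.
Local Hint Resolve Erefl : core.

Lemma Ectx p q u v : u ~ v -> p ++ u ++ q ~ p ++ v ++ q.
Proof. by move=> uv; apply: (fi_cat fE) => //; apply: (fi_cat fE). Qed.

Lemma Econs x u v : u ~ v -> x :: u ~ x :: v.
Proof. by move=> uv; rewrite -cat1s -(cat1s x v); apply: (fi_cat fE). Qed.

Lemma perm_substw h :
    (forall x y, h x ++ h y ~ h y ++ h x) ->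
  forall u v, perm_eq u v -> substw h u ~ substw h v.
Proof.
move=> hC; have front x p q : substw h (p ++ x :: q) ~ h x ++ substw h (p ++ q).
  elim: p => [|y p IH] //=.
  rewrite !substw_cons; apply: (fi_trans fE) (fi_cat fE (Erefl (h y)) IH) _.
  rewrite !catA; exact: (fi_cat fE).
elim=> [|x u IH] v uv; first by rewrite (perm_nilP (etrans (perm_sym _ _) uv)).
have xv : x \in v by rewrite -(perm_mem uv) mem_head.
case/path.splitPr: v / xv uv => p q; rewrite perm_sym -cat1s perm_catCA /=.
rewrite perm_cons perm_sym => /IH uv; rewrite substw_cons.
apply: (fi_trans fE) (fi_sym fE (front x p q)).
exact: (fi_cat fE).
Qed.

(** The words [h x] commute and are idempotent modulo [E], so they generate a semilattice, where a
    product depends only on the set of its factors. *)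
Lemma content_substw h :
    (forall x y, h x ++ h y ~ h y ++ h x) -> (forall x, h x ++ h x ~ h x) ->
  forall u v, u =i v -> substw h u ~ substw h v.
Proof.
move=> hC hI; have und u : substw h u ~ substw h (undup u).
  elim: u => [|x u IH] //=; case: ifP => xu; last exact: (fi_cat fE).
  apply: (fi_trans fE) IH; case/path.splitPr: u / xu => p q.
  have pm : perm_eq (p ++ x :: q) (x :: p ++ q).
    by rewrite -cat1s perm_catCA.
  apply: (fi_trans fE (v := substw h (x :: x :: p ++ q))).
    by apply: perm_substw => //; rewrite perm_cons.
  apply: (fi_trans fE) (perm_substw hC _); last by rewrite perm_sym; apply: pm.
  rewrite !substw_cons catA; exact: (fi_cat fE).
move=> u v uv; apply: (fi_trans fE) (und u) _.
apply: (fi_trans fE) (fi_sym fE (und v)); apply: perm_substw => //.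
by apply: uniq_perm; rewrite ?undup_uniq // => z; rewrite !mem_undup.
Qed.

Definition double_letters (S : pred nat) (w : word) : word :=
  substw (fun x => if S x then [:: x; x] else [:: x]) w.

(** Once doubled, the letters of [S] are commuting idempotents, so a block matters only through its
    content. The induction cuts at the first letter outside [S]; [sb_between] for that letter
    becomes [sb_before] for the tail. *)
Lemma double_blocks (S : pred nat) u v :
    (forall x y, [:: x; x; y; y] ~ [:: y; y; x; x]) ->
    (forall x, [:: x; x; x] ~ [:: x; x]) ->
  same_blocks S u v -> double_letters S u ~ double_letters S v.
Proof.
move=> EL E3.
have all_case b b' : all S b -> all S b' -> b =i b' ->
    double_letters S b ~ double_letters S b'.
  have allE c : all S c -> double_letters S c = substw (fun x => [:: x; x]) c.
    move=> Sc; congr flatten; apply/eq_in_map => x xc.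
    by rewrite (allP Sc).
  move=> Sb Sb' bb'; rewrite !allE //; apply: content_substw => // x.
  by apply: (fi_trans fE) (E3 x); apply: (Econs x (E3 x)).
have [n] := ubnP (size u); elim: n u v => // n IH u v; rewrite ltnS => un uv.
have [Su|] := boolP (all S u).
  apply: all_case => //; last exact: sb_content uv.
  by apply/allP => x; rewrite -(sb_content uv); apply/allP.
move=> /split_all [b [t [c [def_u0 Sb0 St]]]].
have tu : t \in u by rewrite def_u0 mem_cat mem_head orbT.
have tv : t \in v by rewrite -(sb_content uv).
have Sb : all S (before t u).
  by rewrite def_u0 before_cat //; apply: contra St => /(allP Sb0).
have Sb' : all S (before t v).
  by apply/allP => x; rewrite -(sb_before uv St); apply/allP.
have [def_u tbu tau] := count1_split tu (sb_countl uv St).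
have [def_v tbv tav] := count1_split tv (sb_countr uv St).
have caf s w : ~~ S s -> t \in w -> count_mem s w <= 1 ->
    count_mem s (after t w) <= 1.
  move=> Ss tw; apply: leq_trans; rewrite {2}(split_before tw) count_cat /=.
  by rewrite addnA leq_addl.
(* As [t] is the first letter outside [S], another such letter [s] can only occur after it, so
   skipping to [t] first changes nothing. *)
have aft2 w s : ~~ S s -> t \in w -> all S (before t w) -> s != t ->
    after s (after t w) = after s w.
  move=> Ss tw Sbw st; rewrite [in RHS](split_before tw).
  have sb : s \notin before t w by apply: contra Ss => /(allP Sbw).
  have [sa|sa] := boolP (s \in after t w); last first.
    rewrite (after_notin sa) after_notin //.
    by rewrite mem_cat inE !negb_or sb st.
  rewrite [in RHS](split_before sa) -cat_rcons catA after_cat //.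
  by rewrite mem_cat mem_rcons inE (negbTE st) (negbTE sb) (negbTE (before_self s _)).
rewrite def_u def_v /double_letters !substw_cat !substw_cons (negbTE St).
apply: (fi_cat fE); first exact: all_case (sb_before uv St).
apply: (fi_cat fE) => //; apply: IH.
  apply: leq_trans un; rewrite {2}def_u size_cat /= addnS ltnS leq_addl //.
split.
- exact: (sb_after uv).
- by move=> s Ss; apply: caf => //; apply: (sb_countl uv).
- by move=> s Ss; apply: caf => //; apply: (sb_countr uv).
- by move=> s Ss; apply: (sb_between uv).
- move=> s Ss; have [->|st] := eqVneq s t.
    by rewrite (after_notin tau) (after_notin tav).
  by rewrite !aft2 //; apply: (sb_after uv).
- move=> s r Ss Sr; have [->|st] := eqVneq s t.
    by rewrite (after_notin tau) (after_notin tav).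
  by rewrite !aft2 //; apply: (sb_between uv).
Qed.

(** The default of [nth] erases every variable beyond those listed. *)
Lemma subst2 (a b : word) u v : u ~ v ->
  substw (nth [::] [:: a; b]) u ~ substw (nth [::] [:: a; b]) v.
Proof. exact: (fi_subst fE). Qed.

Lemma subst3 (a b c : word) u v : u ~ v ->
  substw (nth [::] [:: a; b; c]) u ~ substw (nth [::] [:: a; b; c]) v.
Proof. exact: (fi_subst fE). Qed.

Lemma split_mem x (p : word) : x \in p -> exists p1 p2, p = p1 ++ x :: p2.
Proof. by case/path.splitPr => p1 p2; exists p1, p2. Qed.

Section Repeat.
Hypothesis E1 : [:: 0; 1; 0] ~ [:: 0; 0; 1; 0].
Hypothesis E2 : [:: 0; 1; 0] ~ [:: 0; 1; 0; 0].

Lemma repeat_letter x p q : (x \in p) || (x \in q) ->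
  p ++ x :: q ~ p ++ x :: x :: q.
Proof.
case/orP => /split_mem [a [b ->]].
  have /(Ectx a q) := subst2 [:: x] b E2.
  by norm_word.
have /(Ectx p b) := subst2 [:: x] a E1.
by norm_word.
Qed.

Lemma repeat_nseq n x p q : (x \in p) || (x \in q) ->
  p ++ x :: q ~ p ++ nseq n.+1 x ++ q.
Proof.
move=> xpq; elim: n => // n IH; apply: (fi_trans fE) IH _.
apply: repeat_letter; case/orP: xpq => xpq; first by rewrite xpq.
by rewrite mem_cat xpq !orbT.
Qed.

Lemma square_cube x : [:: x; x] ~ [:: x; x; x].
Proof. by apply: (@repeat_letter x [:: x] [::]); rewrite mem_head. Qed.

Lemma square_nseq x n : nseq n.+2 x ~ [:: x; x].
Proof.
apply: (fi_sym fE); have := @repeat_nseq n x [:: x] [::].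
by rewrite cats0 mem_head; apply.
Qed.

Lemma double_word (S : pred nat) w :
  (forall x, S x -> x \in w -> 1 < count_mem x w) -> w ~ double_letters S w.
Proof.
(* The prefix [p] keeps the letters already read: they may supply the second occurrence that allows
   the next letter to be doubled. *)
move=> Sw; suff H p q : (forall x, S x -> x \in q ->
    (x \in p) || (1 < count_mem x q)) -> p ++ q ~ p ++ double_letters S q.
  by apply: (H [::]) => x Sx /Sw ->.
elim: q p => // x q IH p H; rewrite /double_letters substw_cons.
have next a : (forall y, y \in x :: p -> y \in a) -> a ++ q ~ a ++ double_letters S q.
  move=> pa; apply: IH => y Sy yq.
  have [->|yx] := eqVneq y x; first by rewrite pa ?mem_head.
  have := H y Sy; rewrite inE yq orbT /= (eq_sym x) (negbTE yx) => /(_ isT).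
  by case/orP => [yp|-> //]; [rewrite pa // inE yp orbT | rewrite orbT].
case: ifP => Sx.
  apply: (fi_trans fE (v := p ++ [:: x; x] ++ q)).
    apply: repeat_letter; have := H x Sx (mem_head _ _).
    rewrite /= eqxx; case/orP => [->//|].
    by rewrite add1n ltnS -has_count has_pred1 => ->; rewrite orbT.
  rewrite !catA; apply: next => y; rewrite !inE mem_cat => /orP[/eqP->|->//].
  by rewrite mem_head orbT.
by rewrite -(cat1s x q) !catA; apply: next => y; rewrite mem_cat !inE orbC.
Qed.

Lemma same_blocks_rel (S : pred nat) u v :
    (forall x, S x -> x \in u -> 1 < count_mem x u) ->
    (forall x, S x -> x \in v -> 1 < count_mem x v) ->
    [:: 0; 0; 1; 1] ~ [:: 1; 1; 0; 0] ->
  same_blocks S u v -> u ~ v.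
Proof.
move=> Su Sv EL uv; apply: (fi_trans fE) (double_word Su) _.
apply: (fi_trans fE) (fi_sym fE (double_word Sv)).
apply: double_blocks uv => [x y|x].
  exact: (subst2 [:: x] [:: y] EL).
exact/(fi_sym fE)/square_cube.
Qed.

Lemma drop_middle x p q : [:: 0; 1; 0; 2; 0] ~ [:: 0; 1; 2; 0] ->
  x \in p -> x \in q -> p ++ x :: q ~ p ++ q.
Proof.
move=> EB /split_mem [a [b ->]] /split_mem [c [d ->]].
have /(Ectx a d) := subst3 [:: x] b c EB.
by norm_word.
Qed.
End Repeat.

End Congruence.

(* Keeps only the first and last occurrence of each letter of [q], given that
   [p] has already been read. *)
Fixpoint drop_middles (p q : word) : word :=
  if q is x :: q' then
    if (x \in p) && (x \in q') then drop_middles p q'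
    else x :: drop_middles (rcons p x) q'
  else [::].

(** The relation is abstract because it serves twice: for the congruence under [id_middle], and for
    [similar], which carries the invariants of the word. *)
Lemma drop_middles_rel (R : word -> word -> Prop) :
    (forall u, R u u) -> (forall v u w, R u v -> R v w -> R u w) ->
    (forall x p q, x \in p -> x \in q -> R (p ++ x :: q) (p ++ q)) ->
  forall p q, R (p ++ q) (p ++ drop_middles p q).
Proof.
move=> Rr Rt Rd p q; elim: q p => // x q IH p /=.
case: ifP => [/andP[xp xq]|_]; first exact: Rt (Rd _ _ _ xp xq) (IH p).
by rewrite -!cat_rcons.
Qed.

(** A letter already in [p] survives only where it does not recur in what follows, hence at its last
    occurrence. *)
Lemma count_drop_middles y p q :
  count_mem y (drop_middles p q) <= (y \notin p).+1.
Proof.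
elim: q p => // x q IH p /=; case: ifP => // xpq /=.
have [xy|xy] /= := eqVneq x y; last first.
  by rewrite (leq_trans (IH _)) // mem_rcons inE eq_sym (negbTE xy).
move: xpq; rewrite xy; case: (y \in p) => /= [yq|_].
  suff /count_memPn -> : y \notin drop_middles (rcons p y) q by [].
  have sub a : {subset drop_middles a q <= q}.
    elim: q a {IH yq} => // z q IH a t /=; case: ifP => _.
      by move/IH; rewrite inE => ->; rewrite orbT.
    by rewrite !inE => /orP[->//|/IH ->]; rewrite orbT.
  by apply: contraFN yq => /sub.
by apply: leq_ltn_trans (IH _) _; rewrite mem_rcons mem_head.
Qed.

Lemma after_catl s p w : s \notin p -> after s (p ++ w) = after s w.
Proof.
move=> sp; rewrite /after index_cat (negbTE sp) -addnS drop_cat.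
by rewrite ltnNge leq_addr /= addKn.
Qed.

Lemma after_catr s p w : s \in p -> after s (p ++ w) = after s p ++ w.
Proof.
move=> sp; rewrite /after index_cat sp drop_cat.
move: sp; rewrite -index_mem leq_eqVlt => /orP[/eqP e|->//].
by rewrite e ltnn subnn drop0 drop_size.
Qed.

Lemma before_catl s p w : s \notin p -> before s (p ++ w) = p ++ before s w.
Proof.
move=> sp; rewrite /before index_cat (negbTE sp) take_cat.
by rewrite ltnNge leq_addr /= addKn.
Qed.

Lemma before_catr s p w : s \in p -> before s (p ++ w) = before s p.
Proof. by move=> sp; rewrite /before index_cat sp take_cat index_mem sp. Qed.

Lemma mem_before_after s t w : s \in w -> count_mem t w <= 1 ->
  (t \in after s w) = [&& t \in w, t != s & t \notin before s w].
Proof.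
move=> /split_before dw; move: (before s w) (after s w) dw => b a ->.
rewrite count_cat /= mem_cat inE -!has_pred1 !has_count (eq_sym t).
by case: (s == t); case: (count_mem t a) (count_mem t b) => [|n] [|[|m]].
Qed.

Lemma mem_sub_before t w x : x \in before t w -> x \in w.
Proof. exact: mem_take. Qed.

Lemma mem_sub_after t w x : x \in after t w -> x \in w.
Proof. exact: mem_drop. Qed.

(** * The seven test identities *)

Definition id_unit : identity := ([:: 0], [::]).
Definition id_idem : identity := ([:: 0], [:: 0; 0]).
Definition id_comm : identity := ([:: 0; 1], [:: 1; 0]).
Definition id_first : identity := ([:: 0; 1; 0], [:: 1; 0; 0]).
Definition id_last : identity := ([:: 0; 1; 0], [:: 0; 0; 1]).
Definition id_middle : identity := ([:: 0; 1; 0; 2; 0], [:: 0; 1; 2; 0]).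
Definition id_order : identity := ([:: 0; 0; 1; 1], [:: 1; 1; 0; 0]).

Definition holds (E : word -> word -> Prop) (e : identity) := E e.1 e.2.

Definition simple (w : word) (x : nat) := count_mem x w <= 1.

Lemma nonsimple_mem w x : ~~ simple w x -> x \in w.
Proof. by rewrite -has_pred1 has_count /simple; case: count. Qed.

(* The theories containing all identities of the join of L_2^1 and Q^1: by
   [st_blocks], blocks and order of first occurrences determine a word. *)
Record subtheory (E : word -> word -> Prop) : Prop := Subtheory {
  st_fi : fully_invariant E;
  st_repeatl : E [:: 0; 1; 0] [:: 0; 0; 1; 0];
  st_repeatr : E [:: 0; 1; 0] [:: 0; 1; 0; 0];
  st_blocks : forall (S : pred nat) u v,
    (forall x, S x -> x \in u -> ~~ simple u x) ->
    (forall x, S x -> x \in v -> ~~ simple v x) ->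
    same_blocks S u v -> same_first u v -> E u v }.

Lemma same_first_content u v : same_first u v -> u =i v.
Proof.
suff H w x : (x \in w) = isSome (first_of w x x) by move=> uv x; rewrite !H uv.
rewrite /first_of -has_pred1 has_filter.
by rewrite (eq_filter (a2 := pred1 x)) => [|y]; [case: filter | rewrite /= orbb].
Qed.

Lemma same_blocks_predT u v : u =i v -> same_blocks predT u v.
Proof. by split. Qed.

Section Subtheory.
Variable E : word -> word -> Prop.
Hypothesis sE : subtheory E.
Let fE := st_fi sE.
Local Notation "u ~ v" := (E u v) (at level 70).
Let Er := Erefl fE.
Local Hint Resolve Er : core.
Let Et := fi_trans fE.
Let Es := fi_sym fE.

Lemma unit_rel u v : holds E id_unit -> u ~ v.
Proof.
move=> H; have nil w : w ~ [::].
  elim: w => // x w IH; apply: Et IH.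
  have := subst2 fE [:: x] [::] H; rewrite /substw /= => Hx.
  exact: (fi_cat fE Hx (Er w)).
exact: Et (nil u) (Es (nil v)).
Qed.

Lemma substw_id u : substw (fun x => [:: x]) u = u.
Proof. exact: flatten_seq1. Qed.

Lemma comm_letters x y : holds E id_comm -> [:: x] ++ [:: y] ~ [:: y] ++ [:: x].
Proof. exact: (subst2 fE [:: x] [:: y]). Qed.

Lemma comm_perm u v : holds E id_comm -> perm_eq u v -> u ~ v.
Proof.
move=> H uv; rewrite -(substw_id u) -(substw_id v); apply: perm_substw => //.
by move=> x y; apply: comm_letters.
Qed.

Lemma comm_idem_rel u v : holds E id_idem -> holds E id_comm -> u =i v -> u ~ v.
Proof.
move=> Hi Hc uv; rewrite -(substw_id u) -(substw_id v).
apply: content_substw => // x *; first exact: comm_letters.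
by apply: Es; apply: (subst2 fE [:: x] [::] Hi).
Qed.

(** Doubling every letter keeps first occurrences and makes all letters non-simple; the block
    conditions then reduce to equal content. *)
Lemma idem_first_rel u v : holds E id_idem -> same_first u v -> u ~ v.
Proof.
move=> H uv; have dbl w : w ~ double_letters predT w.
  elim: w => // x w IH; rewrite /double_letters substw_cons -cat1s.
  apply: (fi_cat fE) => //.
  exact: (subst2 fE [:: x] [::] H).
apply: Et (dbl u) (Et _ (Es (dbl v))).
have mem2 w x : (x \in double_letters predT w) = (x \in w).
  by elim: w => //= y w IH; rewrite /double_letters substw_cons !inE IH orbA orbb.
have cnt w x : predT x -> x \in double_letters predT w ->
    ~~ simple (double_letters predT w) x.
  move=> _; rewrite mem2 /simple -ltnNge -has_pred1 has_count.
  suff -> : count_mem x (double_letters predT w) = (count_mem x w).*2.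
    by case: count.
  elim: w => // y w IH; rewrite /double_letters substw_cons /=.
  by rewrite addnA addnn doubleD; congr addn.
have fst2 w x y : first_of (double_letters predT w) x y = first_of w x y.
  elim: w => // z w; rewrite /first_of /double_letters substw_cons /=.
  by case: ifP => //= ->.
apply: (st_blocks sE (S := predT)) (cnt u) (cnt v) _ _.
  by apply: same_blocks_predT => x; rewrite !mem2 (same_first_content uv).
by move=> x y; rewrite !fst2.
Qed.

Lemma filter_rel (P : pred nat) u v : u ~ v -> filter P u ~ filter P v.
Proof.
have filtE w : filter P w = substw (fun x => if P x then [:: x] else [::]) w.
  by elim: w => //= x w ->; rewrite substw_cons; case: ifP.
by rewrite !filtE; apply: (fi_subst fE).
Qed.

(** Both letters are non-simple, so the whole word is a single block, and content and first
    occurrences decide. *)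
Lemma order_squares x y w : x :: w =i [:: x; y] ->
    ~~ simple (x :: w) x -> ~~ simple (x :: w) y -> x :: w ~ [:: x; x; y; y].
Proof.
move=> mw sx sy; have mw' : x :: w =i [:: x; x; y; y].
  by move=> z; rewrite mw !inE orbb; case: (z == x).
apply: (st_blocks sE (S := predT)); last 2 first.
- exact: same_blocks_predT.
- move=> a b; rewrite /first_of /=; case: ifP => // Px.
  have filt (Q : pred nat) : {in w, pred2 a b =1 Q} ->
      filter (pred2 a b) w = filter Q w by apply: eq_in_filter.
  have mem_w z : z \in w -> z = x \/ z = y.
    by move=> zw; have := mw z; rewrite !inE zw orbT => /esym/orP[]/eqP; [left|right].
  case: ifP => Py; rewrite /= ?Py.
    have: y \in filter (pred2 a b) w.
      have yx : y != x by apply: contraFN Px => /eqP <-.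
      by rewrite mem_filter /= Py; have := mw y; rewrite !inE (negbTE yx) eqxx.
    case def_f: filter => [|z s] // _; have: z \in filter (pred2 a b) w.
      by rewrite def_f mem_head.
    rewrite mem_filter /= => /andP[Pz /mem_w [] zE] //; rewrite zE // in Pz *.
    by rewrite Px in Pz.
  rewrite (eq_in_filter (a2 := pred0)) ?filter_pred0 //.
  by move=> z /mem_w [] ->.
- by move=> z _; rewrite mw !inE => /orP[] /eqP ->.
- move=> z _; rewrite -mw' mw !inE /simple /=.
  case/orP => /eqP ->; rewrite !eqxx; first by case: (y == x).
  by case: (x == y).
Qed.

(** * Test identities forced by a disagreement between the two sides *)

Lemma violates_content u v x : u ~ v -> x \in u -> x \notin v -> holds E id_unit.
Proof.
move=> uv xu xv; pose h y := if y == x then [:: 0] else [::] : word.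
have hE w : substw h w = nseq (count_mem x w) 0.
  elim: w => // y w IH; rewrite substw_cons IH /h /=.
  by case: (y == x).
have := fi_subst fE h uv; rewrite !hE (count_memPn xv) /=.
move: xu; rewrite -has_pred1 has_count; case: (count _ _) => // n _ H.
(* From x^n = 1 with n > 0 follows x^(2n) = 1, that is xx = 1 because xx = xxx; then x = xxx = xx =
   1. *)
have H2 : [:: 0; 0] ~ [::].
  have := fi_cat fE H H; rewrite -nseqD addSn addnS; apply: Et.
  exact/Es/(square_nseq fE (st_repeatl sE) (st_repeatr sE)).
have H3 : [:: 0; 0; 0] ~ [:: 0] := fi_cat fE H2 (Er [:: 0]).
apply: Et (Es H3) (Et _ H2).
exact/Es/(square_cube fE (st_repeatl sE) (st_repeatr sE)).
Qed.

(** Erasing the other letters leaves x = x^n with n > 1, and all powers from the second on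
    coincide. *)
Lemma violates_simple u v x : u ~ v -> u =i v -> simple u x -> ~~ simple v x ->
  holds E id_idem.
Proof.
move=> uv mem_uv ux vx; pose h y := if y == x then [:: 0] else [::] : word.
have hE w : substw h w = nseq (count_mem x w) 0.
  elim: w => // y w IH; rewrite substw_cons IH /h /=.
  by case: (y == x).
have xv := nonsimple_mem vx.
have := fi_subst fE h uv; rewrite !hE.
move: ux vx; rewrite -mem_uv -has_pred1 has_count in xv; rewrite /simple.
case: (count _ u) xv => [|[|m]] // _ _; case: (count _ v) => [|[|n]] // _ H.
exact: Et H (square_nseq fE (st_repeatl sE) (st_repeatr sE) _ _).
Qed.

Lemma first_of_cons w x y z : first_of w x y = Some z ->
  exists2 w', filter (pred2 x y) w = z :: w' & (z == x) || (z == y).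
Proof.
rewrite /first_of; case def_f: filter => [|a s] //= [<-]; exists s => //.
have: a \in filter (pred2 x y) w by rewrite def_f mem_head.
by rewrite mem_filter => /andP[].
Qed.

Lemma first_of_sym w x y : first_of w x y = first_of w y x.
Proof. by congr ohead; apply: eq_filter => t /=; rewrite orbC. Qed.

Lemma first_square w x y c : x != y -> first_of w x y = Some x ->
    {subset c <= [:: x; y]} -> ~~ simple c x -> ~~ simple c y ->
  filter (pred2 x y) w ++ c ~ [:: x; x; y; y].
Proof.
move=> xy /first_of_cons [w' fw _] cxy cx cy; rewrite fw.
have nonsimple z : ~~ simple c z -> ~~ simple (x :: w' ++ c) z.
  by rewrite /simple -cat_cons count_cat -!ltnNge => zc; rewrite ltn_addl.
apply: order_squares; rewrite ?nonsimple // => z.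
rewrite -cat_cons -fw mem_cat mem_filter /= !inE.
have [->|zx] := eqVneq z x.
  rewrite orbC; suff -> : x \in c by []. exact: nonsimple_mem.
have [->|zy] := eqVneq z y.
  rewrite orbC; suff -> : y \in c by []. exact: nonsimple_mem.
apply: contraTF (zx) => /cxy; rewrite !inE (negbTE zy) orbF => ->.
by [].
Qed.

Lemma violates_order u v x y : u ~ v -> u =i v ->
  first_of u x y != first_of v x y -> holds E id_order.
Proof.
(* If neither letter occurred in [u], neither would in [v] and the first occurrences would agree;
   so, up to exchanging [x] and [y], [x] comes first in [u]. *)
move=> uv mem_uv; wlog: x y / first_of u x y = Some x => [hw|].
  case def_f: (first_of u x y) => [z|].
    have [w' _ /orP[] /eqP zE] := first_of_cons def_f; rewrite zE in def_f *.
      by rewrite -def_f; apply: hw.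
    by rewrite -def_f !(first_of_sym _ x y); apply: hw; rewrite -def_f first_of_sym.
  have: has (pred2 x y) v = has (pred2 x y) u by apply/esym/eq_has_r.
  by move: def_f; rewrite /first_of !has_filter; case: filter; case: filter.
move=> fu; rewrite fu => fv.
have [w' fw' _] := first_of_cons fu.
have xu : x \in filter (pred2 x y) u by rewrite fw' mem_head.
have {xu} xv : x \in filter (pred2 x y) v.
  by rewrite mem_filter -mem_uv -mem_filter.
have [z def_v] : exists z, first_of v x y = Some z.
  by move: xv; rewrite /first_of; case: filter => // z s _; exists z.
have [v' _] := first_of_cons def_v; rewrite def_v in fv.
have -> /= : z == x = false by apply: contraNF fv => /eqP ->.
move=> /eqP zy; rewrite zy in def_v fv.
have {fv} xy : x != y by apply: contraNN fv => /eqP ->.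
have sx : ~~ simple [:: x; x; y; y] x by rewrite /simple /= !eqxx; case: (y == x).
have sy : ~~ simple [:: x; x; y; y] y by rewrite /simple /= !eqxx; case: (x == y).
have cxy : {subset [:: x; x; y; y] <= [:: x; y]}.
  by move=> t; rewrite !inE orbA orbb orbb.
have Hu := first_square xy fu cxy sx sy.
have Hv : filter (pred2 x y) v ++ [:: x; x; y; y] ~ [:: y; y; x; x].
  rewrite (eq_filter (a2 := pred2 y x)) => [|t /=]; last by rewrite orbC.
  apply: first_square; rewrite // 1?eq_sym // -1?first_of_sym // => t.
  by rewrite !inE orbA orbb orbb orbC.
(* Appending [xxyy] makes both letters non-simple without changing which comes
   first. *)
have H : [:: x; x; y; y] ~ [:: y; y; x; x].
  apply: Et (Es Hu) (Et _ Hv); apply: (fi_cat fE) => //.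
  exact: filter_rel.
have := fi_subst fE (fun t => if t == x then [:: 0] else [:: 1]) H.
by rewrite /substw /= !eqxx (eq_sym y) (negbTE xy).
Qed.

Lemma simple_split w t : t \in w -> simple w t ->
  [/\ w = before t w ++ t :: after t w, t \notin before t w & t \notin after t w].
Proof. exact: count1_split. Qed.

(** Most uses take [s = t], so that besides [y] a single letter survives, as 1; the form with three
    letters serves [violates_middle]. *)
Definition label (y s t z : nat) : word :=
  if z == y then [:: 0] else if z == s then [:: 1] else
  if z == t then [:: 2] else [::].

Lemma label_pow y s t w : s \notin w -> t \notin w ->
  substw (label y s t) w = nseq (count_mem y w) 0.
Proof.
elim: w => //= z w IH; rewrite !inE !negb_or => /andP[sz sw] /andP[tz tw].
rewrite substw_cons IH // /label eq_sym; case: eqVneq => // _.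
by rewrite !(eq_sym z) (negbTE sz) (negbTE tz).
Qed.

(** Both letters are simple, so erasing all the others leaves exactly xy = yx. *)
Lemma violates_comm u v s t : u ~ v -> u =i v -> simple u s -> simple u t ->
    simple v s -> simple v t -> t \in u ->
  s \in before t u -> s \notin before t v -> holds E id_comm.
Proof.
move=> uv mem_uv us ut vs vt tu su sv.
have tv : t \in v by rewrite -mem_uv.
have st : s != t by apply: contraTneq su => ->; apply: before_self.
have [du tbu tau] := simple_split tu ut; have [dv tbv tav] := simple_split tv vt.
have hE w : t \notin w ->
    substw (label s t t) w = nseq (count_mem s w) 0 by move=> tw; apply: label_pow.
have ht : label s t t t = [:: 1] by rewrite /label (eq_sym t) (negbTE st) eqxx.
have := fi_subst fE (label s t t) uv.
rewrite du dv !substw_cat !substw_cons ht !hE //.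
have := mem_uv s.
rewrite (mem_sub_before su) {1}dv mem_cat inE (negbTE sv) (negbTE st) /=.
move: us vs; rewrite /simple {1}du {1}dv !count_cat /= (eq_sym t) (negbTE st).
move: su sv; rewrite -!has_pred1 !has_count.
by do 4!case: (count _ _) => [|[|?]] //.
Qed.

Lemma rep_nseq n x p q : 0 < n -> (x \in p) || (x \in q) ->
  p ++ nseq n x ++ q ~ p ++ x :: q.
Proof.
case: n => // n _ xpq; apply: Es.
exact: (repeat_nseq fE (st_repeatl sE) (st_repeatr sE)).
Qed.

Lemma pow_around a b w : 0 < a -> 0 < b ->
  nseq a 0 ++ w ++ nseq b 0 ~ 0 :: w ++ [:: 0].
Proof.
move=> a0 b0; apply: (Et (v := 0 :: w ++ nseq b 0)).
  apply: (@rep_nseq a 0 [::]) => //.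
  by case: b b0 => // b _; rewrite mem_cat mem_head orbT.
have := @rep_nseq b 0 (0 :: w) [::] b0; rewrite cats0; apply.
by rewrite mem_head.
Qed.

Lemma mem_beforeP u v t y : u =i v -> y \in before t u -> y \notin before t v ->
  [/\ t \in u, t \in v & y != t].
Proof.
move=> mem_uv yu yv; have tu : t \in u.
  apply: contraR yv => tu; rewrite before_notin -mem_uv ?tu //.
  exact: mem_sub_before yu.
split; rewrite -?mem_uv //.
by apply: contraTneq yu => ->; apply: before_self.
Qed.

Lemma violates_first u v t y : u ~ v -> u =i v -> simple u t -> simple v t ->
  y \in before t u -> y \notin before t v -> holds E id_first.
Proof.
move=> uv mem_uv ut vt yu yv; have [tu tv yt] := mem_beforeP mem_uv yu yv.
have [du tbu tau] := simple_split tu ut; have [dv tbv tav] := simple_split tv vt.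
have hE w : t \notin w ->
    substw (label y t t) w = nseq (count_mem y w) 0 by move=> tw; apply: label_pow.
have ht : label y t t t = [:: 1] by rewrite /label (eq_sym t) (negbTE yt) eqxx.
have := fi_subst fE (label y t t) uv.
rewrite {1}du {1}dv !substw_cat !substw_cons ht !hE // (count_memPn yv).
have yav : 0 < count_mem y (after t v).
  rewrite -has_count has_pred1; have := mem_uv y.
  by rewrite (mem_sub_before yu) {1}dv mem_cat inE (negbTE yv) (negbTE yt).
have ybu : 0 < count_mem y (before t u) by rewrite -has_count has_pred1.
(* [y] may be missing after [t] in [u]; the extra 0 on the right guarantees a power on each side of
   1, and gives [v] at least two 0s after it. *)
move=> /= H; have := fi_cat fE H (Er (nseq 1 0)).
rewrite -!catA !cat_cons -!nseqD !addn1 => {}H.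
rewrite /holds /=; apply: Et (Et _ H) _; first exact/Es/(@pow_around _ _ [:: 1]).
apply: (Econs fE); case: (count _ _) yav => // n _.
exact: (square_nseq fE (st_repeatl sE) (st_repeatr sE)).
Qed.

Lemma mem_afterP w t y : y \in after t w -> t \in w.
Proof. by apply: contraTT => /after_notin ->. Qed.

Lemma violates_last u v t y : u ~ v -> u =i v -> simple u t -> simple v t ->
  y \in after t u -> y \notin after t v -> holds E id_last.
Proof.
move=> uv mem_uv ut vt yu yv; have tu := mem_afterP yu.
have tv : t \in v by rewrite -mem_uv.
have [du tbu tau] := simple_split tu ut; have [dv tbv tav] := simple_split tv vt.
have yt : y != t by apply: contraTneq yu => ->.
have hE w : t \notin w ->
    substw (label y t t) w = nseq (count_mem y w) 0 by move=> tw; apply: label_pow.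
have ht : label y t t t = [:: 1] by rewrite /label (eq_sym t) (negbTE yt) eqxx.
have := fi_subst fE (label y t t) uv.
rewrite {1}du {1}dv !substw_cat !substw_cons ht !hE // (count_memPn yv).
have ybv : 0 < count_mem y (before t v).
  rewrite -has_count has_pred1; have := mem_uv y.
  by rewrite (mem_sub_after yu) {1}dv mem_cat inE (negbTE yv) (negbTE yt) !orbF.
have yau : 0 < count_mem y (after t u) by rewrite -has_count has_pred1.
(* Dually, a 0 is added on the left, since [y] may be missing before [t] in [u]. *)
move=> /= /(Econs fE 0) H.
rewrite /holds /=; apply: Et (Et _ H) _.
  by apply/Es/(@pow_around _.+1 _ [:: 1]).
case: (count _ _) ybv => // n _.
exact: (fi_cat fE (square_nseq fE (st_repeatl sE) (st_repeatr sE) 0 n) (Er [:: 1])).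
Qed.

Lemma violates_middle u v s t y : u ~ v -> u =i v ->
    simple u s -> simple u t -> simple v s -> simple v t ->
    t \in after s u -> t \in after s v ->
    y \in before t (after s u) -> y \notin before t (after s v) ->
  holds E id_middle.
Proof.
move=> uv mem_uv us ut vs vt tsu tsv yu yv.
have dec w : simple w s -> simple w t -> t \in after s w ->
    exists a c, [/\ w = a ++ s :: before t (after s w) ++ t :: c,
      s \notin a ++ before t (after s w) ++ c &
      t \notin a ++ before t (after s w) ++ c].
  move=> ws wt ts; have [dw sb sa] := simple_split (mem_afterP ts) ws.
  have dw2 := split_before ts; exists (before s w), (after t (after s w)).
  split; first by rewrite -dw2.
    move: sa; rewrite {1}dw2 !mem_cat inE !negb_or.
    by case/and3P => -> _ ->; rewrite sb.
  have st : t != s by apply: contraNneq sa => {1}<-.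
  move: wt; rewrite /simple {1}dw {1}dw2 !count_cat /= !count_cat /= eqxx.
  rewrite (eq_sym s) (negbTE st) -!has_pred1 !has_cat !has_count.
  rewrite add0n add1n !addnS ltnS leqn0 !addn_eq0.
  by do 3!case: (count _ _) => [|?].
have [a [c [du us' ut']]] := dec u us ut tsu.
have [a' [c' [dv vs' vt']]] := dec v vs vt tsv.
have ys : y != s.
  by apply: contraNneq us' => {1}<-; rewrite !mem_cat yu orbT.
have yt : y != t by apply: contraTneq yu => ->; apply: before_self.
have st : s != t.
  by apply: contraTneq (tsu) => <-; have [] := simple_split (mem_afterP tsu) us.
have hs : label y s t s = [:: 1] by rewrite /label (eq_sym s) (negbTE ys) eqxx.
have ht : label y s t t = [:: 2].
  by rewrite /label !(eq_sym t) (negbTE yt) (negbTE st) eqxx.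
have := fi_subst fE (label y s t) uv.
rewrite {1}du {1}dv !(substw_cat, substw_cons) hs ht.
move: us' ut' vs' vt'; rewrite !mem_cat !negb_or.
move=> /and3P[? ? ?] /and3P[? ? ?] /and3P[? ? ?] /and3P[? ? ?].
rewrite !label_pow // (count_memPn yv) /= => H.
(* A 0 at each end makes the outer powers positive, so that they shrink to single 0s. *)
have {}H := Econs fE 0 (fi_cat fE H (Er (nseq 1 0))).
move: H; rewrite -?catA ?cat_cons -?catA ?cat_cons -?catA -!nseqD !addn1 => H.
rewrite /holds /=; apply: Et (Et _ H) _; last exact: (@pow_around _.+1 _.+1 [:: 1; 2]).
have := Es (@pow_around (count_mem y a).+1 (count_mem y c).+1
  (1 :: nseq (count_mem y (before t (after s u))) 0 ++ [:: 2]) isT isT).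
rewrite /= -!catA /=; apply: Et; apply: Es.
apply: (@rep_nseq _ 0 [:: 0; 1]) => //.
by rewrite -has_count has_pred1.
Qed.

End Subtheory.

(** * Recovering an identity from the test identities it implies *)

Record same_skeleton (S : pred nat) (u v : word) : Prop := SameSkeleton {
  ss_content : u =i v;
  ss_simplel : forall t, t \in u -> S t = ~~ simple u t;
  ss_simpler : forall t, t \in v -> S t = ~~ simple v t;
  ss_order : forall s t, ~~ S s -> ~~ S t -> t \in u ->
    (s \in before t u) = (s \in before t v) }.

Definition same_before (S : pred nat) (u v : word) :=
  forall t, ~~ S t -> before t u =i before t v.
Definition same_after (S : pred nat) (u v : word) :=
  forall t, ~~ S t -> after t u =i after t v.
(** The guard restricts the condition to genuine gaps. If [t] did not follow [s], [before t] would
    return the whole tail, which appending letters changes. *)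
Definition same_between (S : pred nat) (u v : word) :=
  forall s t, ~~ S s -> ~~ S t -> t \in after s u ->
    before t (after s u) =i before t (after s v).

Lemma simple_notin w t : t \notin w -> simple w t.
Proof. by move=> /count_memPn tw; rewrite /simple tw. Qed.

Section Skeleton.
Variable S : pred nat.

Lemma ss_order_before u v s t : same_skeleton S u v -> ~~ S s -> ~~ S t ->
  (s \in before t u) = (s \in before t v).
Proof.
move=> k Ss St; have [tu|tu] := boolP (t \in u); first exact: (ss_order k).
by rewrite !before_notin -?(ss_content k).
Qed.

Lemma ss_simple u v t : same_skeleton S u v -> ~~ S t -> simple u t.
Proof.
move=> k St; have [tu|/simple_notin //] := boolP (t \in u).
by rewrite -[simple u t]negbK -(ss_simplel k tu).
Qed.

Lemma ss_sym u v : same_skeleton S u v -> same_skeleton S v u.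
Proof.
move=> k; split; first by move=> x; rewrite (ss_content k).
- exact: (ss_simpler k).
- exact: (ss_simplel k).
- by move=> s t Ss St tv; rewrite (ss_order_before k).
Qed.

Lemma ss_order_after u v s t : same_skeleton S u v -> ~~ S s -> ~~ S t ->
  (t \in after s u) = (t \in after s v).
Proof.
move=> k Ss St; have [su|su] := boolP (s \in u); last first.
  by rewrite !after_notin -?(ss_content k).
have sv : s \in v by rewrite -(ss_content k).
have ut := ss_simple k St; have vt := ss_simple (ss_sym k) St.
rewrite !mem_before_after // (ss_content k); congr [&& _, _ & ~~ _].
exact: ss_order_before.
Qed.

Definition few (w : word) := forall t, count_mem t w <= 2.

(** [s] and [t] cut the word into three regions, but [y] has at most two occurrences: if it lies in
    the middle region, it is missing from the left one or from the right one. *)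
Lemma mem_between w s t y : few w -> simple w s -> simple w t -> t \in after s w ->
  (y \in before t (after s w)) =
  [&& y != s, y != t & (y \in before t w) && (y \notin before s w)
    || (y \in after s w) && (y \notin after t w)].
Proof.
move=> w2 ws wt ts; have [dw sb sa] := simple_split (mem_afterP ts) ws.
have dw2 := split_before ts;
move: (before s w) (after s w) (before t (after s w)) (after t (after s w))
  sb sa ts dw2 dw (before_self t (after s w)) => a w' b c sa sw' tw' dw2 dw tb.
have tnsa : t \notin a.
  apply/negP => ta; move: wt; rewrite /simple dw count_cat /=.
  rewrite -has_pred1 has_count in tw'; rewrite -has_pred1 has_count in ta.
  by case: (count _ a) ta (count _ w') tw' => [|m] // _ [|n] // _; rewrite !addnS.
have ts : t != s by apply: contraNneq sw' => <-.
have -> : before t w = a ++ s :: b.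
  rewrite dw dw2 -cat_cons catA before_cat //.
  by rewrite mem_cat inE (negbTE tnsa) (negbTE ts).
have -> : after t w = c.
  rewrite dw dw2 -cat_cons catA after_cat //.
  by rewrite mem_cat inE (negbTE tnsa) (negbTE ts).
rewrite dw2 !mem_cat !inE.
have [->|ys] /= := eqVneq y s.
  by apply/negbTE; apply: contra sw'; rewrite dw2 mem_cat => ->.
have [->|yt] /= := eqVneq y t; first exact/negbTE.
have := w2 y; rewrite dw dw2 !count_cat /= count_cat /=.
rewrite (eq_sym s) (negbTE ys) (eq_sym t) (negbTE yt) -!has_pred1 !has_count.
by case: (count _ a) (count _ b) (count _ c) => [|m] [|n] [|k] //=;
  rewrite !(addnS, addSn).
Qed.

Lemma skeleton_blocks u v : same_skeleton S u v -> same_before S u v ->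
    same_after S u v -> same_between S u v \/ few u /\ few v ->
  same_blocks S u v.
Proof.
move=> k F G B; have k' := ss_sym k; split => //.
- exact: ss_content k.
- by move=> t; apply: (ss_simple k).
- by move=> t; apply: (ss_simple k').
(* If [t] does not follow [s], then [before t] returns the whole tail after [s], which is a matter
   for [same_after]. *)
move=> s t Ss St y; have [ts|ts] := boolP (t \in after s u); last first.
  have ts' : t \notin after s v by rewrite -(ss_order_after k).
  by rewrite (before_notin ts) (before_notin ts'); apply: G.
case: B => [|[u2 v2]]; first exact.
have ts' : t \in after s v by rewrite -(ss_order_after k).
have us := ss_simple k Ss; have vs := ss_simple k' Ss.
have ut := ss_simple k St; have vt := ss_simple k' St.
by rewrite !mem_between // !(F _ _ y) // !(G _ _ y).
Qed.

End Skeleton.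

Section Equivalence.
Variable E : word -> word -> Prop.
Hypothesis sE : subtheory E.
Let fE := st_fi sE.
Let rep := repeat_letter fE (st_repeatl sE) (st_repeatr sE).
Local Notation "u ~ v" := (E u v) (at level 70).
Let Er := Erefl fE.
Local Hint Resolve Er : core.
Let Et := fi_trans fE.
Let Es := fi_sym fE.

Lemma nonsimple_split w y : ~~ simple w y ->
  exists p q, w = p ++ y :: q /\ y \in q.
Proof.
move=> wy; have dw := split_before (nonsimple_mem wy).
exists (before y w), (after y w); split=> //.
move: wy; rewrite /simple {1}dw count_cat /= eqxx (count_memPn (before_self y w)).
by rewrite -ltnNge add0n add1n ltnS -has_count has_pred1.
Qed.

Lemma nonsimple_catl w p x : ~~ simple w x -> ~~ simple (p ++ w) x.
Proof. by rewrite /simple count_cat -!ltnNge => h; rewrite ltn_addl. Qed.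

Lemma nonsimple_catr w p x : ~~ simple w x -> ~~ simple (w ++ p) x.
Proof. by rewrite /simple count_cat -!ltnNge => h; rewrite ltn_addr. Qed.

(** From p y q, with y again in q, one gets p y y q and then y p y q by reading [id_first] from
    right to left. *)
Lemma prepend Y w : holds E id_first -> (forall y, y \in Y -> ~~ simple w y) ->
  w ~ Y ++ w.
Proof.
move=> H; elim: Y => // y Y IH YW /=.
have {}IH : w ~ Y ++ w by apply: IH => z zY; apply: YW; rewrite inE zY orbT.
apply: Et IH _; have := nonsimple_catl Y (YW y (mem_head _ _)).
case/nonsimple_split => p [q [-> yq]]; apply: Et (rep _) _; first by rewrite yq orbT.
have := Ectx fE [::] q (subst2 fE [:: y] p H).
by norm_word; apply: Es.
Qed.

(** Mirror of [prepend]: p y q becomes p y y q and then p y q y. *)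
Lemma append Y w : holds E id_last -> (forall y, y \in Y -> ~~ simple w y) ->
  w ~ w ++ Y.
Proof.
move=> H; elim/last_ind: Y => [|Y y IH] YW; first by rewrite cats0.
have {}IH : w ~ w ++ Y.
  by apply: IH => z zY; apply: YW; rewrite mem_rcons inE zY orbT.
apply: Et IH _; rewrite -cats1 catA.
have: ~~ simple (w ++ Y) y by apply/nonsimple_catr/YW; rewrite mem_rcons mem_head.
case/nonsimple_split => p [q [-> yq]]; apply: Et (rep _) _; first by rewrite yq orbT.
have := Ectx fE p [::] (subst2 fE [:: y] q H).
by norm_word; apply: Es.
Qed.

Lemma notin_filter (S : pred nat) (w : word) t : ~~ S t -> t \notin filter S w.
Proof. by rewrite mem_filter => /negbTE ->. Qed.

Lemma simple_catl (S : pred nat) w' w t : ~~ S t ->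
  simple (filter S w' ++ w) t = simple w t.
Proof. by move=> St; rewrite /simple count_cat (count_memPn (notin_filter w' St)). Qed.

Lemma simple_catr (S : pred nat) w' w t : ~~ S t ->
  simple (w ++ filter S w') t = simple w t.
Proof.
by move=> St; rewrite /simple count_cat (count_memPn (notin_filter w' St)) addn0.
Qed.

(* [id_first] lets the non-simple letters be prepended, after which each of them
   occurs before every simple letter. *)
Lemma make_same_before S u v : holds E id_first -> same_skeleton S u v ->
  exists u' v', [/\ u ~ u', v ~ v', same_skeleton S u' v' & same_before S u' v'] /\
    [/\ same_after S u v -> same_after S u' v',
        same_between S u v -> same_between S u' v' &
        same_first u v -> same_first u' v'].
Proof.
move=> H k; set Y := filter S u.
have nY t : ~~ S t -> t \notin Y by apply: notin_filter.
have Yu y : y \in Y -> ~~ simple u y.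
  by rewrite mem_filter => /andP[Sy yu]; rewrite -(ss_simplel k yu).
have Yv y : y \in Y -> ~~ simple v y.
  rewrite mem_filter => /andP[Sy yu]; rewrite -(ss_simpler k) //.
  by rewrite -(ss_content k).
exists (Y ++ u), (Y ++ v); split; last first.
  split.
  - move=> G t St y; rewrite !after_catl ?nY //; exact: G.
  - move=> B s t Ss St; rewrite !after_catl ?nY //; exact: B.
  - by move=> L x y; have := L x y; rewrite /first_of !filter_cat; case: (filter _ Y).
split.
- exact: prepend.
- exact: prepend.
- split.
  + by move=> x; rewrite !mem_cat (ss_content k).
  + move=> t; rewrite mem_cat => tYu.
    have tu : t \in u by case/orP: tYu => //; rewrite mem_filter => /andP[].
    have [St|St] := boolP (S t); last first.
      by rewrite simple_catl // -(ss_simplel k tu) (negbTE St).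
    by apply/esym/nonsimple_catl; rewrite -(ss_simplel k tu).
  + move=> t; rewrite mem_cat => tYv.
    have tv : t \in v.
      by case/orP: tYv => //; rewrite mem_filter (ss_content k) => /andP[].
    have [St|St] := boolP (S t); last first.
      by rewrite simple_catl // -(ss_simpler k tv) (negbTE St).
    by apply/esym/nonsimple_catl; rewrite -(ss_simpler k tv).
  + move=> s t Ss St _; rewrite !before_catl ?nY // !mem_cat.
    by rewrite (ss_order_before k).
move=> t St y; rewrite !before_catl ?nY // !mem_cat mem_filter.
have [Sy|Sy] := boolP (S y); last by rewrite (ss_order_before k).
have [yu|yu] //= := boolP (y \in u).
rewrite !(contraNF (@mem_sub_before t _ y)) // -?(ss_content k) //.
Qed.

Lemma make_same_after S u v : holds E id_last -> same_skeleton S u v ->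
  exists u' v', [/\ u ~ u', v ~ v', same_skeleton S u' v' & same_after S u' v'] /\
    [/\ same_before S u v -> same_before S u' v',
        same_between S u v -> same_between S u' v' &
        same_first u v -> same_first u' v'].
Proof.
move=> H k; set Y := filter S u.
have nY t : ~~ S t -> t \notin Y by apply: notin_filter.
have Yu y : y \in Y -> ~~ simple u y.
  by rewrite mem_filter => /andP[Sy yu]; rewrite -(ss_simplel k yu).
have Yv y : y \in Y -> ~~ simple v y.
  rewrite mem_filter => /andP[Sy yu]; rewrite -(ss_simpler k) //.
  by rewrite -(ss_content k).
have nilY (P : pred nat) w : u =i w -> filter P w = [::] -> filter P Y = [::].
  move=> uw /eqP; rewrite -[filter P w == _]negbK -has_filter -(eq_has_r uw) => Pw.
  apply/eqP; rewrite -[_ == _]negbK -has_filter; apply: contra Pw => /hasP[y].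
  by rewrite mem_filter => /andP[_ yu] Py; apply/hasP; exists y.
(* If [t] does not occur, [before t] is the whole word; the letters of [Y] already belong to [w], so
   the content is unchanged. *)
have before_app t w y : ~~ S t -> u =i w ->
    (y \in before t (w ++ Y)) = (y \in before t w).
  move=> St uw; have [tw|tw] := boolP (t \in w); first by rewrite before_catr.
  rewrite (before_notin tw) before_notin; last first.
    by rewrite mem_cat negb_or tw nY.
  rewrite mem_cat; apply/orb_idr; rewrite mem_filter -uw => /andP[] //.
have after_app t w : ~~ S t ->
    after t (w ++ Y) = if t \in w then after t w ++ Y else [::].
  move=> St; case: ifP => tw; first by rewrite after_catr.
  by rewrite after_notin // mem_cat tw nY.
exists (u ++ Y), (v ++ Y); split; last first.
  split.
  - by move=> F t St y; rewrite !before_app //; [apply: F | apply: ss_content k].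
  - move=> B s t Ss St; rewrite !after_app // -(ss_content k).
    case: ifP => // su; rewrite mem_cat (negbTE (nY _ St)) orbF => ts.
    rewrite !before_catr // -?(ss_order_after k) //; exact: B.
  - move=> L x y; have := L x y; rewrite /first_of !filter_cat.
    have := nilY (pred2 x y) u; have := nilY (pred2 x y) v (ss_content k).
    case: (filter _ u) => [|a s]; case: (filter _ v) => [|b r] //=.
split.
- exact: append.
- exact: append.
- split.
  + by move=> x; rewrite !mem_cat (ss_content k).
  + move=> t; rewrite mem_cat => tYu.
    have tu : t \in u by case/orP: tYu => //; rewrite mem_filter => /andP[].
    have [St|St] := boolP (S t); last first.
      by rewrite simple_catr // -(ss_simplel k tu) (negbTE St).
    by apply/esym/nonsimple_catr; rewrite -(ss_simplel k tu).
  + move=> t; rewrite mem_cat => tYv.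
    have tv : t \in v.
      by case/orP: tYv => //; rewrite mem_filter (ss_content k) => /andP[].
    have [St|St] := boolP (S t); last first.
      by rewrite simple_catr // -(ss_simpler k tv) (negbTE St).
    by apply/esym/nonsimple_catr; rewrite -(ss_simpler k tv).
  + move=> s t Ss St _; rewrite !before_app //; last exact: ss_content k.
    exact: ss_order_before k Ss St.
move=> t St y; rewrite !after_app // -(ss_content k); case: ifP => // tu.
rewrite !mem_cat mem_filter.
have [Sy|Sy] := boolP (S y); last by rewrite (ss_order_after k).
have [yu|yu] /= := boolP (y \in u); first by rewrite !orbT.
by rewrite !(contraNF (@mem_sub_after t _ y)) // -?(ss_content k).
Qed.

(** Invariants under deletion of a middle occurrence. The contents of the gaps between simple
    letters are left out on purpose, since they do change. *)
Definition similar (u v : word) :=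
  [/\ u =i v, simple u =1 simple v, same_first u v &
      forall t, simple u t -> before t u =i before t v /\ after t u =i after t v].

Lemma similar_refl u : similar u u. Proof. by []. Qed.

Lemma similar_trans v u w : similar u v -> similar v w -> similar u w.
Proof.
move=> [c1 s1 f1 b1] [c2 s2 f2 b2]; split.
- by move=> x; rewrite c1.
- by move=> x; rewrite s1.
- by move=> x y; rewrite f1.
- move=> t ut; have [b1' a1'] := b1 t ut; have vt : simple v t by rewrite -s1.
  by have [b2' a2'] := b2 t vt; split=> x; rewrite (b1', a1').
Qed.

Lemma similar_drop x p q : x \in p -> x \in q -> similar (p ++ x :: q) (p ++ q).
Proof.
move=> xp xq; have cp : 0 < count_mem x p by rewrite -has_count has_pred1.
have cq : 0 < count_mem x q by rewrite -has_count has_pred1.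
have xn : ~~ simple (p ++ x :: q) x.
  by rewrite /simple count_cat -ltnNge; apply: (@leq_add 1 1 _ _ cp); rewrite /= eqxx.
have xn' : ~~ simple (p ++ q) x.
  by rewrite /simple count_cat -ltnNge; apply: (@leq_add 1 1 _ _ cp).
split.
- by move=> z; rewrite !mem_cat inE; case: eqVneq => // ->; rewrite xp.
- move=> z; have [->|zx] := eqVneq z x; first by rewrite (negbTE xn) (negbTE xn').
  by rewrite /simple !count_cat /= (eq_sym x) (negbTE zx).
- move=> a b; rewrite /first_of !filter_cat /=; case: ifP => // Px.
  have: x \in filter (pred2 a b) p by rewrite mem_filter /= Px xp.
  by case: filter.
move=> t ts; have tx : t != x by apply: contraTneq ts => ->.
have [tp|tp] := boolP (t \in p).
  rewrite !before_catr // !after_catr //; split=> // z; rewrite !mem_cat inE.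
  by case: eqVneq => // ->; rewrite xq.
rewrite !before_catl // !after_catl // -cat1s before_catl ?after_catl ?inE //.
by split=> // z; rewrite !mem_cat inE; case: eqVneq => // ->; rewrite xp.
Qed.

Lemma few_drop w : few (drop_middles [::] w).
Proof. by move=> t; apply: leq_trans (count_drop_middles t [::] w) _. Qed.

Lemma similar_drop_middles w : similar w (drop_middles [::] w).
Proof.
apply: (drop_middles_rel (R := similar) similar_refl _ _ [::] w).
  by move=> v u z; apply: similar_trans.
exact: similar_drop.
Qed.

Lemma middle_rel w : holds E id_middle -> w ~ drop_middles [::] w.
Proof.
move=> H; apply: (drop_middles_rel (R := E) Er Et _ [::] w) => x p q.
exact: (drop_middle fE H).
Qed.

Lemma similar_skeleton S u v u' v' : similar u u' -> similar v v' ->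
  same_skeleton S u v -> same_skeleton S u' v'.
Proof.
move=> [cu su fu bu] [cv sv fv bv] k; split.
- by move=> x; rewrite -cu -cv (ss_content k).
- by move=> t; rewrite -cu -su => /(ss_simplel k).
- by move=> t; rewrite -cv -sv => /(ss_simpler k).
- move=> s t Ss St _; have [bu' _] := bu t (ss_simple k St).
  have [bv' _] := bv t (ss_simple (ss_sym k) St).
  by rewrite -bu' -bv' (ss_order_before k).
Qed.

Lemma skeleton_rel S u v : same_skeleton S u v ->
    same_before S u v \/ holds E id_first ->
    same_after S u v \/ holds E id_last ->
    same_between S u v \/ holds E id_middle ->
    same_first u v \/ holds E id_order ->
  u ~ v.
Proof.
move=> k F; wlog {F} F : u v k / same_before S u v.
  move=> hw G B L; case: F => [F|F]; first exact: hw.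
  have [u' [v' [[uu' vv' k' F'] [G' B' L']]]] := make_same_before F k.
  apply: Et uu' (Et _ (Es vv')); apply: hw => //.
  - by case: G => ?; [left; apply: G' | right].
  - by case: B => ?; [left; apply: B' | right].
  - by case: L => ?; [left; apply: L' | right].
move=> G; wlog {G} G : u v k F / same_after S u v.
  move=> hw B L; case: G => [G|G]; first exact: hw.
  have [u' [v' [[uu' vv' k' G'] [F' B' L']]]] := make_same_after G k.
  apply: Et uu' (Et _ (Es vv')); apply: hw => //; first exact: F'.
  - by case: B => ?; [left; apply: B' | right].
  - by case: L => ?; [left; apply: L' | right].
(* The gaps are not made equal: they are traded for at most two occurrences of each letter, which
   [skeleton_blocks] accepts instead. *)
move=> B; wlog {B} B : u v k F G / same_between S u v \/ few u /\ few v.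
  move=> hw L; case: B => [B|B]; first by apply: hw => //; left.
  have Du := similar_drop_middles u; have Dv := similar_drop_middles v.
  apply: Et (middle_rel u B) (Et _ (Es (middle_rel v B))).
  have [cu su fu bu] := Du; have [cv sv fv bv] := Dv.
  have kv := ss_sym k.
  apply: hw.
  - exact: similar_skeleton k.
  - move=> t St x; have [bu' _] := bu t (ss_simple k St).
    by have [bv' _] := bv t (ss_simple kv St); rewrite -bu' -bv' F.
  - move=> t St x; have [_ bu'] := bu t (ss_simple k St).
    by have [_ bv'] := bv t (ss_simple kv St); rewrite -bu' -bv' G.
  - by right; split; apply: few_drop.
  - by case: L => L; [left=> x y; rewrite -fu -fv L | right].
have uv := skeleton_blocks k F G B.
have Su x : S x -> x \in u -> ~~ simple u x by move=> Sx /(ss_simplel k) <-.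
have Sv x : S x -> x \in v -> ~~ simple v x by move=> Sx /(ss_simpler k) <-.
(* Either first occurrences agree and [st_blocks] applies, or squares commute and equal blocks are
   enough. *)
case=> L; first exact: (st_blocks sE Su Sv uv).
apply: (same_blocks_rel fE (st_repeatl sE) (st_repeatr sE) _ _ L uv) => x.
  by move=> Sx /(Su x Sx); rewrite ltnNge.
by move=> Sx /(Sv x Sx); rewrite ltnNge.
Qed.

End Equivalence.

Definition test_identities : seq identity :=
  [:: id_unit; id_idem; id_comm; id_first; id_last; id_middle; id_order].

(** * Implications between the test identities *)

Section Consequences.
Variable E : word -> word -> Prop.
Hypothesis sE : subtheory E.
Let fE := st_fi sE.
Local Notation "u ~ v" := (E u v) (at level 70).
Let Er := Erefl fE.
Let Et := fi_trans fE.
Let Es := fi_sym fE.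

(** xyx and xxy have the same first occurrences, which is all that counts under x = xx. *)
Lemma idem_last : holds E id_idem -> holds E id_last.
Proof.
move=> H; apply: (idem_first_rel sE) => // x y.
by rewrite /first_of /=; do !case: ifP.
Qed.

Lemma idem_order_comm : holds E id_idem -> holds E id_order -> holds E id_comm.
Proof.
move=> H Ho; have sq x : [:: x] ~ [:: x; x] := subst2 fE [:: x] [::] H.
apply: Et (fi_cat fE (sq 0) (sq 1)) (Et Ho _).
exact/Es/(fi_cat fE (sq 1) (sq 0)).
Qed.

Lemma comm_first : holds E id_comm -> holds E id_first.
Proof. by move=> H; apply: (comm_perm sE). Qed.

Lemma comm_last : holds E id_comm -> holds E id_last.
Proof. by move=> H; apply: (comm_perm sE). Qed.

Lemma comm_order : holds E id_comm -> holds E id_order.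
Proof. by move=> H; apply: (comm_perm sE). Qed.

(** xxyy = xyxy = yxxy = yyxx: the middle step is [id_first], the outer ones hold in every
    subtheory. *)
Lemma first_order : holds E id_first -> holds E id_order.
Proof.
move=> H; apply: (Et (v := [:: 0; 1; 0; 1])).
  apply/Es/(order_squares sE) => // z.
  by rewrite !inE; case: (z == 0); case: (z == 1).
apply: (Et (v := [:: 1; 0; 0; 1])); first exact: (fi_cat fE H (Er [:: 1])).
apply: (order_squares sE) => // z.
by rewrite !inE; case: (z == 0); case: (z == 1).
Qed.

(** xyxzx = yxxzx = yxzx = yxzxx = yzxxx = yzxx = xyzx, with [id_first] at the first, fourth and
    last steps and repetition laws at the others. *)
Lemma first_middle : holds E id_first -> holds E id_middle.
Proof.
move=> H; apply: (Et (v := [:: 1; 0; 2; 0; 0])).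
  apply: (Et (v := [:: 1; 0; 0; 2; 0])); first exact: (fi_cat fE H (Er [:: 2; 0])).
  apply: (Et (v := [:: 1; 0; 2; 0])).
    exact/Es/(@repeat_letter _ fE (st_repeatl sE) (st_repeatr sE) 0 [:: 1] [:: 2; 0]).
  exact/(@repeat_letter _ fE (st_repeatl sE) (st_repeatr sE) 0 [:: 1; 0; 2] [::]).
apply: (Et (v := [:: 1; 2; 0; 0])); last exact/Es/(subst2 fE [:: 0] [:: 1; 2] H).
apply: (Et (v := [:: 1; 2; 0; 0; 0])).
  exact: (Ectx fE [:: 1] [:: 0] (subst2 fE [:: 0] [:: 2] H)).
exact/(fi_cat fE (Er [:: 1; 2]))/Es/(square_cube fE (st_repeatl sE) (st_repeatr sE)).
Qed.

(** xyxzx = xxyxzx = xxxyzx = xxyzx = xyzx, with [id_last] at the second step. *)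
Lemma last_middle : holds E id_last -> holds E id_middle.
Proof.
move=> H; apply: (Et (v := [:: 0; 0; 1; 2; 0])).
  apply: (Et (v := [:: 0; 0; 1; 0; 2; 0])).
    exact/(@repeat_letter _ fE (st_repeatl sE) (st_repeatr sE) 0 [::] [:: 1; 0; 2; 0]).
  apply: (Et (v := [:: 0; 0; 0; 1; 2; 0])).
    exact: (Ectx fE [:: 0] [:: 2; 0] H).
  have sq := square_cube fE (st_repeatl sE) (st_repeatr sE) 0.
  exact: (fi_cat fE (Es sq) (Er [:: 1; 2; 0])).
exact/Es/(@repeat_letter _ fE (st_repeatl sE) (st_repeatr sE) 0 [::] [:: 1; 2; 0]).
Qed.

End Consequences.

(** * Test identities equivalent to a given identity *)

Definition unless (P : Prop) (e : identity) : seq identity :=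
  if `[< P >] then [::] else [:: e].

Lemma mem_unless (P : Prop) e e' : (e' \in unless P e) <-> ~ P /\ e' = e.
Proof.
rewrite /unless; case: asboolP => p; split=> //; first by case.
  by rewrite inE => /eqP.
by case=> _ ->; rewrite mem_head.
Qed.

(** When the simple letters differ, x = xx is forced, and a disagreement in first occurrences then
    amounts to commutativity rather than to [id_order] alone. When the skeletons differ,
    commutativity is forced and implies the four remaining identities, so nothing else is listed. *)
Definition reduct (u v : word) : seq identity :=
  let S := fun t => ~~ simple u t in
  if ~~ `[< u =i v >] then [:: id_unit] else
  if ~~ `[< simple u =1 simple v >] then
    id_idem :: unless (same_first u v) id_comm else
  if ~~ `[< same_skeleton S u v >] then [:: id_comm] else
  unless (same_before S u v) id_first ++ unless (same_after S u v) id_last ++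
  unless (same_between S u v) id_middle ++ unless (same_first u v) id_order.

Lemma reduct_sub u v : {subset reduct u v <= test_identities}.
Proof.
move=> e; rewrite /reduct; do 3?[case: ifP => _].
- by rewrite inE => /eqP ->.
- by rewrite inE => /orP[/eqP -> //|/mem_unless [_ -> //]].
- by rewrite inE => /eqP ->.
by rewrite !mem_cat => /or4P[] /mem_unless [_ ->].
Qed.

Lemma unless_holds E P e : (forall e', e' \in unless P e -> holds E e') ->
  P \/ holds E e.
Proof.
move=> H; have [p|np] := pselect P; [by left | right].
by apply: H; apply/mem_unless.
Qed.

Lemma uniq_filter_simple (P : pred nat) w : (forall t, P t -> simple w t) ->
  uniq (filter P w).
Proof.
move=> Pw; apply: count_mem_uniq => t; case: (boolP (t \in _)) => [tw|].
  apply/eqP; rewrite eqn_leq -has_count has_pred1 tw andbT.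
  move: tw; rewrite mem_filter => /andP[/Pw + _]; apply: leq_trans.
  by rewrite count_filter; apply: sub_count => x /andP[].
by move/count_memPn.
Qed.

Lemma count_mem_filter (P : pred nat) w t : P t ->
  count_mem t (filter P w) = count_mem t w.
Proof.
move=> Pt; rewrite count_filter; apply: eq_count => x /=.
by case: eqVneq => // ->.
Qed.

Lemma reductP E u v : subtheory E ->
  E u v <-> (forall e, e \in reduct u v -> holds E e).
Proof.
move=> sE; rewrite /reduct; case: (asboolP (u =i v)) => /= c; last first.
  split=> [uv e|H]; last by apply: (unit_rel sE); apply: H; rewrite mem_head.
  rewrite inE => /eqP ->; apply: contrapT => nH; apply: c => x.
  apply/idP/idP => [xu|xv]; apply: contraT => xn.
    by case: nH; apply: (violates_content sE uv xu).
  by case: nH; apply: (violates_content sE (fi_sym (st_fi sE) uv) xv).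
case: (asboolP (simple u =1 simple v)) => /= si; last first.
  split=> [uv|H]; last first.
    have Hi : holds E id_idem by apply: H; rewrite mem_head.
    have [f|Hc] : same_first u v \/ holds E id_comm.
    - by apply: unless_holds => e He; apply: H; rewrite inE He orbT.
    - exact: (idem_first_rel sE).
    - exact: (comm_idem_rel sE).
  have Hi : holds E id_idem.
    apply: contrapT => nH; apply: si => x.
    apply/idP/idP => [xu|xv]; apply: contraT => xn; case: nH.
      exact: (violates_simple sE uv c xu xn).
    by apply: (violates_simple sE (fi_sym (st_fi sE) uv) _ xv xn) => t; rewrite c.
  move=> e; rewrite inE => /orP[/eqP -> //|/mem_unless [nf ->]].
  apply: idem_order_comm => //; apply: contrapT => nH; apply: nf => x y.
  apply/eqP; apply: contraT => xy; case: nH; exact: (violates_order sE uv c xy).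
have si' t : simple v t = simple u t by rewrite si.
set S := fun t => _.
have nS t : ~~ S t -> simple u t by rewrite /S negbK.
case: (asboolP (same_skeleton S u v)) => /= k; last first.
  have eqS t : S t = ~~ simple v t by rewrite /S si.
  split=> [uv e|H].
    rewrite inE => /eqP ->; apply: contrapT => nH; apply: k; split=> // s t Ss St tu.
    have [us ut] := (nS s Ss, nS t St).
    apply/idP/idP => [sb|sb]; apply: contraT => sn; case: nH.
      by apply: (violates_comm sE uv c us ut) sb sn; rewrite // si'.
    apply: (violates_comm sE (fi_sym (st_fi sE) uv) _ _ _ us ut _ sb sn).
    - by move=> z; rewrite c.
    - by rewrite si'.
    - by rewrite si'.
    - by rewrite -c.
  have Hc : holds E id_comm by apply: H; rewrite mem_head.
  (* Under commutativity the simple letters can be collected in front, where both words have the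
     same ones; the non-simple rest is a single block. *)
  have dec w : E w (filter (predC S) w ++ filter S w).
    by apply: (comm_perm sE Hc); rewrite perm_sym perm_catC perm_filterC.
  apply: (fi_trans (st_fi sE)) (dec u) _.
  apply: (fi_trans (st_fi sE)) (fi_sym (st_fi sE) (dec v)).
  apply: (fi_cat (st_fi sE)).
    apply: (comm_perm sE Hc); apply: uniq_perm.
    - by apply: uniq_filter_simple => t /nS.
    - by apply: uniq_filter_simple => t /nS; rewrite si.
    - by move=> t; rewrite !mem_filter c.
  apply: (same_blocks_rel (S := predT) (st_fi sE) (st_repeatl sE) (st_repeatr sE)).
  - by move=> t _; rewrite mem_filter => /andP[St tu]; rewrite count_mem_filter // ltnNge.
  - move=> t _; rewrite mem_filter => /andP[St tu].
    by rewrite count_mem_filter // ltnNge; move: St; rewrite eqS.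
  - exact: comm_order.
  - by apply: same_blocks_predT => t; rewrite !mem_filter c.
have kS := ss_sym k; split=> [uv e|H].
  have vu := fi_sym (st_fi sE) uv; have c' : v =i u by move=> t; rewrite c.
  have nS' t : ~~ S t -> simple v t by move=> /nS; rewrite si.
  rewrite !mem_cat => /or4P[] /mem_unless [n ->];
    apply: contrapT => nH; apply: n.
  - move=> t St y; apply/idP/idP => [yb|yb]; apply: contraT => yn; case: nH.
      exact: (violates_first sE uv c (nS t St) (nS' t St) yb yn).
    exact: (violates_first sE vu c' (nS' t St) (nS t St) yb yn).
  - move=> t St y; apply/idP/idP => [yb|yb]; apply: contraT => yn; case: nH.
      exact: (violates_last sE uv c (nS t St) (nS' t St) yb yn).
    exact: (violates_last sE vu c' (nS' t St) (nS t St) yb yn).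
  - move=> s t Ss St ts y; have ts' : t \in after s v by rewrite -(ss_order_after k).
    apply/idP/idP => [yb|yb]; apply: contraT => yn; case: nH.
      exact: (violates_middle sE uv c (nS s Ss) (nS t St) (nS' s Ss) (nS' t St)
        ts ts' yb yn).
    exact: (violates_middle sE vu c' (nS' s Ss) (nS' t St) (nS s Ss) (nS t St)
      ts' ts yb yn).
  - move=> x y; apply/eqP; apply: contraT => xy; case: nH.
    exact: (violates_order sE uv c xy).
apply: (skeleton_rel sE k); apply: unless_holds => e He; apply: H.
- by rewrite !mem_cat He.
- by rewrite !mem_cat He orbT.
- by rewrite !mem_cat He !orbT.
- by rewrite !mem_cat He !orbT.
Qed.

Lemma holds_rel E E' : subtheory E -> subtheory E' ->
    (forall e, e \in test_identities -> holds E e -> holds E' e) ->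
  forall u v, E u v -> E' u v.
Proof.
move=> sE sE' H u v /(reductP _ _ sE) uv; apply/(reductP _ _ sE') => e He.
by apply: H; [apply: reduct_sub He | apply: uv].
Qed.

(** * Finite monoids given by multiplication tables *)

Section Eval.
Local Open Scope group_scope.

Lemma eval_cons (M : monoidType) (f : nat -> M) x w :
  eval f (x :: w) = f x * eval f w.
Proof. exact: big_cons. Qed.

Lemma eval_cat (M : monoidType) (f : nat -> M) u v :
  eval f (u ++ v) = eval f u * eval f v.
Proof. exact: big_cat. Qed.

Lemma eval_substw (M : monoidType) (f : nat -> M) h w :
  eval f (substw h w) = eval (fun x => eval f (h x)) w.
Proof.
elim: w => [|x w IH]; first by rewrite /eval !big_nil.
by rewrite substw_cons eval_cat eval_cons IH.
Qed.

End Eval.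

Definition theory (V : monoid_class) (u v : word) :=
  forall M, V M -> satisfies M (u, v).

Lemma satisfies_fi (M : monoidType) :
  fully_invariant (fun u v => satisfies M (u, v)).
Proof.
split=> [u f //|u v uv f|v u w uv vw f|u u' v v' uu' vv' f|h u v uv f] /=.
- by rewrite (uv f).
- by rewrite (uv f) (vw f).
- by rewrite !eval_cat (uu' f) (vv' f).
- by rewrite !eval_substw (uv _).
Qed.

Lemma theory_fi V : fully_invariant (theory V).
Proof.
split=> [u M VM|u v uv M VM|v u w uv vw M VM|u u' v v' uu' vv' M VM|h u v uv M VM];
  have fM := satisfies_fi M.
- exact: (fi_refl fM).
- exact: (fi_sym fM (uv M VM)).
- exact: (fi_trans fM (uv M VM) (vw M VM)).
- exact: (fi_cat fM (uu' M VM) (vv' M VM)).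
- exact: (fi_subst fM h (uv M VM)).
Qed.

(* A finite monoid on the codes 0, ..., size T - 1, with identity 0, given by
   the rows of its multiplication table. *)
Definition table := seq (seq nat).
Definition mulT (T : table) (i j : nat) : nat := nth 0 (nth [::] T i) j.
Definition evalT (A : Type) (T : table) (g : A -> nat) (w : seq A) : nat :=
  foldr (fun x => mulT T (g x)) 0 w.
Definition codes (T : table) := iota 0 (size T).

Definition satT (T : table) (e : identity) :=
  forall g : nat -> nat, (forall x, g x < size T) -> evalT T g e.1 = evalT T g e.2.

Definition wf_table (T : table) : bool :=
  [&& 0 < size T,
      all (fun i => all (fun j => mulT T i j < size T) (codes T)) (codes T),
      all (fun i => (mulT T 0 i == i) && (mulT T i 0 == i)) (codes T) &
      all (fun i => all (fun j => all (fun k =>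
        mulT T i (mulT T j k) == mulT T (mulT T i j) k)
        (codes T)) (codes T)) (codes T)].

Section Table.
Variable T : table.
Hypothesis wfT : wf_table T.

Lemma mem_codes i : (i \in codes T) = (i < size T).
Proof. by rewrite mem_iota. Qed.

Lemma table_gt0 : 0 < size T. Proof. by case/and4P: wfT. Qed.

Lemma mulT_lt i j : i < size T -> j < size T -> mulT T i j < size T.
Proof.
rewrite -!mem_codes => iT jT; case/and4P: wfT => _ /allP/(_ i iT)/allP H _ _.
by rewrite mem_codes H.
Qed.

Lemma mul0T i : i < size T -> mulT T 0 i = i.
Proof.
by rewrite -mem_codes; case/and4P: wfT => _ _ /allP H _ /H /andP[/eqP].
Qed.

Lemma mulT0 i : i < size T -> mulT T i 0 = i.
Proof.
by rewrite -mem_codes; case/and4P: wfT => _ _ /allP H _ /H /andP[_ /eqP].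
Qed.

Lemma mulTA i j k : i < size T -> j < size T -> k < size T ->
  mulT T i (mulT T j k) = mulT T (mulT T i j) k.
Proof.
rewrite -!mem_codes => iT jT kT; case/and4P: wfT => _ _ _ /allP/(_ i iT)/allP.
by move=> /(_ j jT)/allP/(_ k kT)/eqP.
Qed.

Lemma evalT_lt A (g : A -> nat) w : (forall x, g x < size T) ->
  evalT T g w < size T.
Proof. by move=> gT; elim: w => [|x w IH] /=; [apply: table_gt0 | apply: mulT_lt]. Qed.

Lemma evalT_cat A (g : A -> nat) u v : (forall x, g x < size T) ->
  evalT T g (u ++ v) = mulT T (evalT T g u) (evalT T g v).
Proof.
move=> gT; elim: u => [|x u IH] /=; first by rewrite mul0T ?evalT_lt.
by rewrite IH mulTA ?evalT_lt.
Qed.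

End Table.

(** An isomorphism onto the codes: equality in a monoid given by a presentation does not compute,
    whereas equality of codes does. *)
Definition represented (M : monoidType) (T : table) :=
  exists phi : M -> nat, [/\ injective phi, phi 1%g = 0,
    forall a b, phi (a * b)%g = mulT T (phi a) (phi b),
    forall a, phi a < size T & forall i, i < size T -> exists a, phi a = i].

Lemma represented_sat M T e : represented M T -> satisfies M e <-> satT T e.
Proof.
case=> phi [phi_inj phi1 phiM phi_lt phi_onto].
have phiE f w : phi (eval f w) = evalT T (phi \o f) w.
  by elim: w => [|x w IH]; rewrite ?eval_cons ?phiM ?IH // /eval big_nil.
split=> [He g gT|He f]; last by apply: phi_inj; rewrite !phiE; apply: He => x /=.
have [f fE] := choice (fun x => phi_onto (g x) (gT x)).
have gE w : evalT T g w = evalT T (phi \o f) w.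
  by elim: w => //= x w ->; rewrite fE.
by rewrite !gE -!phiE He.
Qed.

(** Three values suffice because the test identities use only the variables 0, 1 and 2; the default
    0 of [nth] is the code of the identity element. *)
Definition satb (T : table) (e : identity) : bool :=
  all (fun a => all (fun b => all (fun c =>
    evalT T (nth 0 [:: a; b; c]) e.1 == evalT T (nth 0 [:: a; b; c]) e.2)
    (codes T)) (codes T)) (codes T).

Lemma satbP T e : 0 < size T -> all (gtn 3) (e.1 ++ e.2) -> satT T e <-> satb T e.
Proof.
move=> T0; rewrite all_cat => /andP[e1 e2]; split=> [H|H g gT].
  apply/allP => a; rewrite mem_codes => aT; apply/allP => b; rewrite mem_codes => bT.
  apply/allP => c; rewrite mem_codes => cT; apply/eqP/H => x.
  by case: x => [|[|[|x]]] //=; rewrite nth_nil.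
have gE w : all (gtn 3) w -> evalT T g w = evalT T (nth 0 [:: g 0; g 1; g 2]) w.
  by elim: w => //= x w IH /andP[x3 /IH ->]; case: x x3 => [|[|[|]]].
rewrite !gE //; apply/eqP; move: (g 0) (g 1) (g 2) (gT 0) (gT 1) (gT 2) => a b c.
rewrite -!mem_codes => aT bT cT.
by move/allP: H => /(_ a aT) /allP/(_ b bT)/allP/(_ c cT).
Qed.

(* [h] lists the graph of a map from a submonoid of the square of T to T'. *)
Definition divides (h : seq (nat * nat * nat)) (T T' : table) : bool :=
  [&& (0, 0, 0) \in h,
      all (fun p => all (fun q => ((mulT T p.1.1 q.1.1, mulT T p.1.2 q.1.2),
        mulT T' p.2 q.2) \in h) h) h,
      all (fun p => all (fun q => (p.1 == q.1) ==> (p.2 == q.2)) h) h,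
      all (fun p => (p.1.1 < size T) && (p.1.2 < size T)) h &
      all (fun k => k \in unzip2 h) (codes T')].

(** [T'] is a quotient of a submonoid of the square of [T], and identities pass to powers,
    submonoids and quotients. *)
Lemma divides_sat h T T' e : divides h T T' -> satT T e -> satT T' e.
Proof.
case/and5P => h0 /allP hM /allP hF /allP hT /allP hT' He g gT.
have lift k : k < size T' -> exists p, p \in h /\ p.2 = k.
  by rewrite -mem_codes => /hT' /mapP[p ph ->]; exists p.
have [f fE] := choice (fun x => lift (g x) (gT x)).
have evalE w : ((evalT T (fun x => (f x).1.1) w, evalT T (fun x => (f x).1.2) w),
    evalT T' g w) \in h.
  elim: w => //= x w IH; have [fx fxE] := fE x.
  by have /allP/(_ _ IH) := hM _ fx; rewrite /= fxE.
have lt1 x : (f x).1.1 < size T by have [/hT /andP[]] := fE x.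
have lt2 x : (f x).1.2 < size T by have [/hT /andP[]] := fE x.
have /allP/(_ _ (evalE e.2)) := hF _ (evalE e.1).
by rewrite (He _ lt1) (He _ lt2) eqxx => /eqP.
Qed.

Lemma represented_adjoin1 (P : semigroupType) (T : table)
    (phi : P -> nat) (el : nat -> P) :
    0 < size T -> wf_table T ->
    (forall p q, phi (p * q)%g = mulT T (phi p) (phi q)) ->
    (forall j, 0 < j < size T -> phi (el j) = j) ->
    (forall p, exists2 j, 0 < j < size T & p = el j) ->
  represented (adjoin1 P) T.
Proof.
move=> T0 wfT phiM phiE onto.
have phi_lt p : 0 < phi p < size T by have [j jT ->] := onto p; rewrite phiE.
exists (fun p : adjoin1 P => if p is Some q then phi q else 0); split.
- move=> [p|] [q|] //=.
  + have [i iT ->] := onto p; have [j jT ->] := onto q.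
    by rewrite !phiE // => ->.
  + by move=> p0; have := phi_lt p; rewrite p0.
  + by move=> q0; have := phi_lt q; rewrite -q0.
- by [].
- move=> [p|] [q|] //=; rewrite ?mulT0 ?mul0T //.
  + by have /andP[] := phi_lt p.
  + by have /andP[] := phi_lt q.
- by case=> [p|] //; have /andP[] := phi_lt p.
case=> [|i] iT; first by exists None.
by exists (Some (el i.+1)); rewrite phiE.
Qed.

Section PresentedTable.
Variables (A : choiceType).
Variable R : seq (free_semigroup A * free_semigroup A).
Variables (T : table) (g : A -> nat) (nf : nat -> free_semigroup A).
Local Open Scope group_scope.
Local Open Scope quotient_scope.
Local Notation pi := (fun w => \pi_(presented R) w).
Hypothesis wfT : wf_table T.
Hypothesis g_lt : forall x, g x < size T.

Definition valT (w : free_semigroup A) : nat := evalT T g (w.1 :: w.2).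

Hypothesis valR : all (fun r => valT r.1 == valT r.2) R.
Hypothesis val_nf : all (fun j => valT (nf j) == j) (behead (codes T)).
Hypothesis pi_gen : forall x, 0 < g x /\ pi (gen x) = pi (nf (g x)).
Hypothesis pi_mul : forall x j, 0 < j < size T ->
  0 < mulT T (g x) j /\ pres_mul (pi (gen x)) (pi (nf j)) = pi (nf (mulT T (g x) j)).

Lemma valT_mul u v : valT (u * v) = mulT T (valT u) (valT v).
Proof.
by rewrite /valT -[RHS](evalT_cat wfT _ _ g_lt) /=.
Qed.

Lemma valT_congruence u v : congruence R u v -> valT u = valT v.
Proof.
elim=> [{}u {}v uv||??? ->|???? -> _ ->|????? E1 ? E2] //.
  by apply/eqP; have /allP/(_ _ uv) := valR.
by rewrite !valT_mul E1 E2.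
Qed.

(** The table satisfies the relations, so distinct codes stay distinct in the presented semigroup.
    Conversely, left multiplication by a generator stays among the normal forms [nf], so induction
    on words shows that there are no other elements. *)
Lemma represented_presented : represented (adjoin1 (presented R)) T.
Proof.
have rep w : valT (repr (pi w)) = valT w.
  exact/valT_congruence/congruence_repr.
apply: (@represented_adjoin1 (presented R) _ (fun p : presented R => valT (repr p))
  (fun j => pi (nf j))) => //.
- exact: table_gt0.
- by move=> p q; rewrite rep valT_mul.
- move=> j /andP[j0 jT]; rewrite rep; apply/eqP.
  apply: (allP val_nf); rewrite /codes; case: (size T) jT => // n jn.
  by rewrite /= mem_iota j0.
move=> p; rewrite -[p]reprK; case: (repr p) => x s; elim: s x => [|y s IH] x.
  by have [gx ->] := pi_gen x; exists (g x); rewrite ?gx ?g_lt.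
have [j jT yE] := IH y; have [m0 mE] := pi_mul x jT.
exists (mulT T (g x) j); last first.
  by rewrite -mE -yE pres_mul_pi.
by rewrite m0 mulT_lt //; case/andP: jT.
Qed.

End PresentedTable.

(** * Multiplication tables of the named monoids *)

Section Relations.
Local Open Scope group_scope.
Local Open Scope quotient_scope.

Lemma pi_rel (A : choiceType) (R : seq (free_semigroup A * free_semigroup A)) u v :
  (u, v) \in R -> \pi_(presented R) u = \pi_(presented R) v.
Proof.
move=> uv; apply/(eqmodP (congruence_equiv R)); apply/asboolP.
exact: congr_rel.
Qed.

Lemma pi_zerol n R x (p := fun w => \pi_(presented (R ++ zero_rels n)) w) :
  pres_mul (p (gen None)) (p (gen x)) = p (gen None).
Proof.
rewrite pres_mul_pi; apply: pi_rel; rewrite !mem_cat.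
apply/orP; right; apply/orP; left.
by apply/mapP; exists x; rewrite ?mem_enum.
Qed.

Lemma pi_zeror n R x (p := fun w => \pi_(presented (R ++ zero_rels n)) w) :
  pres_mul (p (gen x)) (p (gen None)) = p (gen None).
Proof.
rewrite pres_mul_pi; apply: pi_rel; rewrite !mem_cat.
apply/orP; right; apply/orP; right.
by apply/mapP; exists x; rewrite ?mem_enum.
Qed.

Lemma all_zero_rels n
    (P : pred (free_semigroup (option 'I_n) * free_semigroup (option 'I_n))) :
    (forall x, P (gen None * gen x, gen None)) ->
    (forall x, P (gen x * gen None, gen None)) ->
  all P (zero_rels n).
Proof.
by move=> P1 P2; rewrite all_cat; apply/andP; split; apply/allP => r /mapP[x _ ->].
Qed.

End Relations.

(* In the tables with a zero, 1 codes the zero; the generators a, b, c (x, y for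
   the factor monoids) follow, and then bc in Q (xy in the factor monoid). *)
Definition Q_table : table :=
  [:: [:: 0; 1; 2; 3; 4; 5]; [:: 1; 1; 1; 1; 1; 1]; [:: 2; 1; 2; 3; 1; 5];
      [:: 3; 1; 1; 1; 5; 1]; [:: 4; 1; 4; 1; 1; 1]; [:: 5; 1; 5; 1; 1; 1]].
Definition B0_table : table :=
  [:: [:: 0; 1; 2; 3; 4]; [:: 1; 1; 1; 1; 1]; [:: 2; 1; 2; 1; 4];
      [:: 3; 1; 1; 3; 1]; [:: 4; 1; 1; 4; 1]].
Definition I_table : table :=
  [:: [:: 0; 1; 2; 3]; [:: 1; 1; 1; 1]; [:: 2; 1; 1; 2]; [:: 3; 1; 1; 3]].
Definition J_table : table :=
  [:: [:: 0; 1; 2; 3]; [:: 1; 1; 1; 1]; [:: 2; 1; 1; 1]; [:: 3; 1; 2; 3]].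
Definition L2_table : table :=
  [:: [:: 0; 1; 2]; [:: 1; 1; 1]; [:: 2; 2; 2]].
Definition M0_table : table := [:: [:: 0; 1]; [:: 1; 1]].
Definition Mx_table : table := [:: [:: 0; 1; 2]; [:: 1; 1; 1]; [:: 2; 1; 1]].
Definition Mxy_table : table :=
  [:: [:: 0; 1; 2; 3; 4]; [:: 1; 1; 1; 1; 1]; [:: 2; 1; 1; 4; 1];
      [:: 3; 1; 1; 1; 1]; [:: 4; 1; 1; 1; 1]].

Lemma ord2_cases (x : 'I_2) : x = ord0 \/ x = ord_max.
Proof. by case: x => [[|[|]]] // i; [left | right]; apply: val_inj. Qed.

Lemma ord3_cases (x : 'I_3) :
  [\/ x = @Ordinal 3 0 isT, x = @Ordinal 3 1 isT | x = @Ordinal 3 2 isT].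
Proof.
by case: x => [[|[|[|]]]] // i; [apply: Or31 | apply: Or32 | apply: Or33];
  apply: val_inj.
Qed.

Definition code (n : nat) (x : option 'I_n) : nat :=
  if x is Some i then i.+2 else 1.

Section ThreeGenerators.
Local Open Scope group_scope.
Local Open Scope quotient_scope.
Let a := gen (Some (@Ordinal 3 0 isT)).
Let b := gen (Some (@Ordinal 3 1 isT)).
Let c := gen (Some (@Ordinal 3 2 isT)).
Let z : free_semigroup (option 'I_3) := gen None.

Lemma Q_represented : represented (adjoin1 (presented0 Q_rels)) Q_table.
Proof.
pose P := presented (Q_rels ++ zero_rels 3); pose p w := \pi_P w.
have rel u v w : (u * v, w) \in Q_rels -> pres_mul (p u) (p v) = p w.
  by move=> uv; rewrite pres_mul_pi; apply: pi_rel; rewrite mem_cat uv.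
have zx x : pres_mul (p z) (p (gen x)) = p z := pi_zerol Q_rels x.
have xz x : pres_mul (p (gen x)) (p z) = p z := pi_zeror Q_rels x.
have aa : pres_mul (p a) (p a) = p a by apply: rel.
have ab : pres_mul (p a) (p b) = p b by apply: rel.
have ca : pres_mul (p c) (p a) = p c by apply: rel.
have ac : pres_mul (p a) (p c) = p z by apply: rel.
have ba : pres_mul (p b) (p a) = p z by apply: rel.
have cb : pres_mul (p c) (p b) = p z by apply: rel.
(* Of the products missing from the relations, bb and cc vanish, since [a] can be inserted next to
   one factor and annihilates the other; bc is a new element. *)
have bb : pres_mul (p b) (p b) = p z.
  by rewrite -[in X in pres_mul _ X]ab pres_mulA ba zx.
have cc : pres_mul (p c) (p c) = p z.
  by rewrite -[in X in pres_mul X _]ca -pres_mulA ac xz.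
have bc : \pi_P (b * c) = pres_mul (p b) (p c) by rewrite pres_mul_pi.
apply: (@represented_presented _ (Q_rels ++ zero_rels 3) Q_table (@code 3)
  (fun j => nth z [:: z; z; a; b; c; b * c] j)) => //.
- by case=> // x; case: (ord3_cases x) => ->.
- rewrite all_cat; apply/andP; split=> //.
  by apply: all_zero_rels; case=> // x; case: (ord3_cases x) => ->.
- by case=> [x|]; [case: (ord3_cases x) => -> | split].
move=> x j j5; case: x => [x|]; [case: (ord3_cases x) => -> |];
  case: j j5 => [|[|[|[|[|[|]]]]]] //= _; split => //;
  by rewrite ?bc ?pres_mulA ?(xz, aa, ab, ac, ba, bb, ca, cb, cc, zx).
Qed.

Lemma B0_represented : represented (adjoin1 (presented0 B0_rels)) B0_table.
Proof.
pose P := presented (B0_rels ++ zero_rels 3); pose p w := \pi_P w.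
have rel u v w : (u * v, w) \in B0_rels -> pres_mul (p u) (p v) = p w.
  by move=> uv; rewrite pres_mul_pi; apply: pi_rel; rewrite mem_cat uv.
have zx x : pres_mul (p z) (p (gen x)) = p z := pi_zerol B0_rels x.
have xz x : pres_mul (p (gen x)) (p z) = p z := pi_zeror B0_rels x.
have aa : pres_mul (p a) (p a) = p a by apply: rel.
have bb : pres_mul (p b) (p b) = p b by apply: rel.
have ab : pres_mul (p a) (p b) = p z by apply: rel.
have ba : pres_mul (p b) (p a) = p z by apply: rel.
have ac : pres_mul (p a) (p c) = p c by apply: rel.
have cb : pres_mul (p c) (p b) = p c by apply: rel.
have bc : pres_mul (p b) (p c) = p z.
  by rewrite -[in X in pres_mul _ X]ac pres_mulA ba zx.
have ca : pres_mul (p c) (p a) = p z.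
  by rewrite -[in X in pres_mul X _]cb -pres_mulA ba xz.
have cc : pres_mul (p c) (p c) = p z.
  by rewrite -[in X in pres_mul X _]cb -pres_mulA bc xz.
apply: (@represented_presented _ (B0_rels ++ zero_rels 3) B0_table (@code 3)
  (fun j => nth z [:: z; z; a; b; c] j)) => //.
- by case=> // x; case: (ord3_cases x) => ->.
- rewrite all_cat; apply/andP; split=> //.
  by apply: all_zero_rels; case=> // x; case: (ord3_cases x) => ->.
- by case=> [x|]; [case: (ord3_cases x) => -> | split].
move=> x j j5; case: x => [x|]; [case: (ord3_cases x) => -> |];
  case: j j5 => [|[|[|[|[|]]]]] //= _; split => //;
  by rewrite ?(xz, aa, ab, ac, ba, bb, bc, ca, cb, cc, zx).
Qed.

End ThreeGenerators.

Section TwoGenerators.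
Local Open Scope group_scope.
Local Open Scope quotient_scope.
Let a := gen (Some (ord0 : 'I_2)).
Let b := gen (Some (ord_max : 'I_2)).
Let z : free_semigroup (option 'I_2) := gen None.

Lemma I_represented : represented (adjoin1 (presented0 I_rels)) I_table.
Proof.
pose P := presented (I_rels ++ zero_rels 2); pose p w := \pi_P w.
have rel u v w : (u * v, w) \in I_rels -> pres_mul (p u) (p v) = p w.
  by move=> uv; rewrite pres_mul_pi; apply: pi_rel; rewrite mem_cat uv.
have zx x : pres_mul (p z) (p (gen x)) = p z := pi_zerol I_rels x.
have xz x : pres_mul (p (gen x)) (p z) = p z := pi_zeror I_rels x.
have ab : pres_mul (p a) (p b) = p a by apply: rel.
have ba : pres_mul (p b) (p a) = p z by apply: rel.
have bb : pres_mul (p b) (p b) = p b by apply: rel.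
have aa : pres_mul (p a) (p a) = p z.
  by rewrite -[in X in pres_mul X _]ab -pres_mulA ba xz.
apply: (@represented_presented _ (I_rels ++ zero_rels 2) I_table (@code 2)
  (fun j => nth z [:: z; z; a; b] j)) => //.
- by case=> // x; case: (ord2_cases x) => ->.
- rewrite all_cat; apply/andP; split=> //.
  by apply: all_zero_rels; case=> // x; case: (ord2_cases x) => ->.
- by case=> [x|]; [case: (ord2_cases x) => -> | split].
move=> x j j5; case: x => [x|]; [case: (ord2_cases x) => -> |];
  case: j j5 => [|[|[|[|]]]] //= _; split => //;
  by rewrite ?(xz, aa, ab, ba, bb, zx).
Qed.

Lemma J_represented : represented (adjoin1 (presented0 J_rels)) J_table.
Proof.
pose P := presented (J_rels ++ zero_rels 2); pose p w := \pi_P w.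
have rel u v w : (u * v, w) \in J_rels -> pres_mul (p u) (p v) = p w.
  by move=> uv; rewrite pres_mul_pi; apply: pi_rel; rewrite mem_cat uv.
have zx x : pres_mul (p z) (p (gen x)) = p z := pi_zerol J_rels x.
have xz x : pres_mul (p (gen x)) (p z) = p z := pi_zeror J_rels x.
have ba : pres_mul (p b) (p a) = p a by apply: rel.
have ab : pres_mul (p a) (p b) = p z by apply: rel.
have bb : pres_mul (p b) (p b) = p b by apply: rel.
have aa : pres_mul (p a) (p a) = p z.
  by rewrite -[in X in pres_mul _ X]ba pres_mulA ab zx.
apply: (@represented_presented _ (J_rels ++ zero_rels 2) J_table (@code 2)
  (fun j => nth z [:: z; z; a; b] j)) => //.
- by case=> // x; case: (ord2_cases x) => ->.
- rewrite all_cat; apply/andP; split=> //.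
  by apply: all_zero_rels; case=> // x; case: (ord2_cases x) => ->.
- by case=> [x|]; [case: (ord2_cases x) => -> | split].
move=> x j j5; case: x => [x|]; [case: (ord2_cases x) => -> |];
  case: j j5 => [|[|[|[|]]]] //= _; split => //;
  by rewrite ?(xz, aa, ab, ba, bb, zx).
Qed.

Lemma L2_represented : represented (adjoin1 (presented L2_rels)) L2_table.
Proof.
pose p w := \pi_(presented L2_rels) w; pose a' := gen (ord0 : 'I_2).
pose b' := gen (ord_max : 'I_2).
have rel u v w : (u * v, w) \in L2_rels -> pres_mul (p u) (p v) = p w.
  by move=> uv; rewrite pres_mul_pi; apply: pi_rel.
have aa : pres_mul (p a') (p a') = p a' by apply: rel.
have ab : pres_mul (p a') (p b') = p a' by apply: rel.
have bb : pres_mul (p b') (p b') = p b' by apply: rel.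
have ba : pres_mul (p b') (p a') = p b' by apply: rel.
apply: (@represented_presented _ L2_rels L2_table (fun x => x.+1)
  (fun j => nth a' [:: a'; a'; b'] j)) => //.
- by move=> x; case: (ord2_cases x) => ->.
- by move=> x; case: (ord2_cases x) => ->.
move=> x j j5; case: (ord2_cases x) => ->;
  by case: j j5 => [|[|[|]]] //= _; split => //; rewrite ?(aa, ab, ba, bb).
Qed.

End TwoGenerators.

(** The empty word heads the list and so receives code 0; [bump 1] skips code 1, which is reserved
    for the zero. *)
Lemma represented_factor (W : set word) (ws : seq word) (T : table) :
    (forall w, factor_of W w = (w \in [::] :: ws)) -> uniq ([::] :: ws) ->
    size T = (size ws).+2 -> wf_table T ->
    let cd w := bump 1 (index w ([::] :: ws)) in
    all (fun u => all (fun v => mulT T (cd u) (cd v) ==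
      if u ++ v \in [::] :: ws then cd (u ++ v) else 1) ([::] :: ws)) ([::] :: ws) ->
    all (fun i => (mulT T 1 i == 1) && (mulT T i 1 == 1)) (codes T) ->
  represented (factor_monoid W) T.
Proof.
move=> fW uW sT wfT cd mulE zeroE.
pose phi (m : factor_monoid W) := if m is Some w then cd (val w) else 1.
have val_in (w : {w | factor_of W w}) : val w \in [::] :: ws by rewrite -fW (valP w).
have phi_lt m : phi m < size T.
  rewrite sT; case: m => [w|]; last by [].
  rewrite /phi /cd /bump; have := val_in w; rewrite -index_mem.
  by move: (index _ _) => [|n].
have cd_inj u v : u \in [::] :: ws -> v \in [::] :: ws -> cd u = cd v -> u = v.
  by move=> uw vw /(can_inj (bumpK 1)); apply: index_inj.
have cd1 u : cd u != 1 by rewrite eq_sym neq_bump.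
exists phi; split.
- move=> [u|] [v|] //=; last 2 first.
  + by move/eqP; rewrite (negbTE (cd1 _)).
  + by move/esym/eqP; rewrite (negbTE (cd1 _)).
  by move=> e; congr Some; apply/val_inj/cd_inj.
- by [].
- move=> m1 m2; have z i : i < size T -> mulT T 1 i = 1 /\ mulT T i 1 = 1.
    by rewrite -mem_codes => /(allP zeroE) /andP[/eqP -> /eqP ->].
  case: m1 m2 => [u|] [v|]; last 3 first.
  + by case: (z _ (phi_lt (Some u))) => _ ->.
  + by case: (z _ (phi_lt (Some v))) => -> _.
  + by case: (z _ (phi_lt None)) => -> _.
  have /allP/(_ _ (val_in v))/eqP /= -> := allP mulE _ (val_in u).
  rewrite /mul /= /factor_mul; case: insubP => [w|]; rewrite fW => uv.
    by move=> /= ->; rewrite uv.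
  by rewrite (negbTE uv).
- by [].
case=> [|[|i]] iT; first by exists 1%g.
  by exists None.
have iws : i.+1 < size ([::] :: ws) by move: iT; rewrite sT.
have wi : factor_of W (nth [::] ([::] :: ws) i.+1) by rewrite fW mem_nth.
exists (Some (exist (fun w => factor_of W w) _ wi) : factor_monoid W).
by rewrite -[LHS]/(cd (nth [::] ([::] :: ws) i.+1)) /cd index_uniq.
Qed.

Lemma M0_represented : represented (factor_monoid set0) M0_table.
Proof.
apply: (@represented_factor _ [::]) => // w; rewrite inE.
by apply/asboolP/eqP => [[|[]]|]; [| |left].
Qed.

Lemma factor_of1 (u w : word) : u != [::] -> factor_of [set u] w = infix w u.
Proof.
move=> u0; apply/asboolP/idP => [[->|[_ -> //]]|wu]; first exact: infix0s.
by right; exists u.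
Qed.

Lemma Mx_represented x : represented (factor_monoid [set [:: x]]) Mx_table.
Proof.
apply: (@represented_factor _ [:: [:: x]]) => //.
  by move=> w; rewrite factor_of1 // infixs1 !inE.
by rewrite /= !inE !eqseq_cons !eqxx.
Qed.

Lemma Mxy_represented x y : x != y ->
  represented (factor_monoid [set [:: x; y]]) Mxy_table.
Proof.
move=> xy; have yx : y == x = false by rewrite eq_sym (negbTE xy).
apply: (@represented_factor _ [:: [:: x]; [:: y]; [:: x; y]]) => //.
- move=> w; rewrite factor_of1 // !inE; case: w => [|a [|b [|c w]]] //.
  + by rewrite infix1s !inE !eqseq_cons !andbT !andbF !orbF.
  + by rewrite /= !eqseq_cons !andbF !andbT !orbF.
  + by apply/idP/idP => [/size_infix //|]; rewrite !eqseq_cons !andbF.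
- by rewrite /= !inE !eqseq_cons !(negbTE xy, yx, eqxx).
by rewrite /= !inE !eqseq_cons !(negbTE xy, yx, eqxx).
Qed.

Local Open Scope classical_set_scope.

(** * Signatures of varieties *)

(** In a left zero semigroup a product equals its leftmost factor, so the first letter not sent to
    the identity decides. *)
Lemma evalT_L2 (g : nat -> nat) w : (forall x, g x < 3) ->
  evalT L2_table g w = if filter (fun x => g x != 0) w is x :: _ then g x else 0.
Proof.
move=> g3; elim: w => //= x w ->.
have y3 : (if filter (fun x => g x != 0) w is y :: _ then g y else 0) < 3.
  by case: filter.
move: y3 (g3 x); case gx: (g x) => [|n] /=; last rewrite gx.
  by case: (if _ is _ :: _ then _ else _) => [|[|[|]]].
case: (if _ is _ :: _ then _ else _) => [|[|[|]]] //;
  by case: n {gx} => [|[|[]]].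
Qed.

Lemma same_first_L2 u v : same_first u v -> satT L2_table (u, v).
Proof.
move=> uv g g3; rewrite /= !evalT_L2 //.
have has_uv : has (fun x => g x != 0) u = has (fun x => g x != 0) v.
  exact/eq_has_r/same_first_content.
move: has_uv; rewrite !has_filter.
case fu: (filter _ u) => [|x u']; case fv: (filter _ v) => [|y v'] // _.
(* Restricted to the deciding letters [x] of [u] and [y] of [v], one word starts with [x] and the
   other with [y]; equal first occurrences force [x = y]. *)
have first_in w z t s : filter (fun x => g x != 0) w = z :: s -> g t != 0 ->
    first_of w z t = Some z /\ first_of w t z = Some z.
  move=> fw gt; have gz : g z != 0.
    have: z \in filter (fun x => g x != 0) w by rewrite fw mem_head.
    by rewrite mem_filter => /andP[].
  rewrite (first_of_sym w t); suff -> : first_of w z t = Some z by [].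
  move: fw; rewrite /first_of.
  elim: w => //= a w IH; case: ifP => ga.
    by case=> -> _; rewrite eqxx.
  have [az|_] := eqVneq a z; first by rewrite az gz in ga.
  have [at'|_] := eqVneq a t; first by rewrite at' gt in ga.
  exact: IH.
have gx : g x != 0.
  have: x \in filter (fun x => g x != 0) u by rewrite fu mem_head.
  by rewrite mem_filter => /andP[].
have gy : g y != 0.
  have: y \in filter (fun x => g x != 0) v by rewrite fv mem_head.
  by rewrite mem_filter => /andP[].
have [ux _] := first_in _ _ _ _ fu gy; have [_ vy] := first_in _ _ _ _ fv gx.
by move: (uv x y); rewrite ux vy => -[->].
Qed.

Lemma satT_test T e : wf_table T -> e \in test_identities ->
  satT T e <-> satb T e.
Proof.
move=> wfT eT; apply: satbP; first exact: table_gt0.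
have /allP : all (fun e => all (gtn 3) (e.1 ++ e.2)) test_identities by [].
exact.
Qed.

(** First occurrences settle [L_2^1]. For [Q^1] equal blocks suffice by [same_blocks_rel], because
    its table satisfies both repetition laws and xxyy = yyxx. *)
Lemma subtheory_X (E : word -> word -> Prop) : fully_invariant E ->
    (forall e, satT L2_table e -> satT Q_table e -> E e.1 e.2) ->
  subtheory E.
Proof.
move=> fE HE.
have HEb e : all (gtn 3) (e.1 ++ e.2) -> satb L2_table e -> satb Q_table e ->
    E e.1 e.2.
  by move=> e3 s1 s2; apply: HE; apply/satbP.
split=> //.
- exact: (HEb ([:: 0; 1; 0], [:: 0; 0; 1; 0])).
- exact: (HEb ([:: 0; 1; 0], [:: 0; 1; 0; 0])).
move=> S u v Su Sv uv fuv; apply: (HE (u, v)); first exact: same_first_L2.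
apply/(represented_sat _ Q_represented).
have Qb e : all (gtn 3) (e.1 ++ e.2) -> satb Q_table e ->
    satisfies (adjoin1 (presented0 Q_rels)) e.
  by move=> e3 se; apply/(represented_sat _ Q_represented)/satbP.
apply: (same_blocks_rel (satisfies_fi _) _ _ _ _ _ uv).
- exact: Qb.
- exact: Qb.
- by move=> x Sx /(Su x Sx); rewrite ltnNge.
- by move=> x Sx /(Sv x Sx); rewrite ltnNge.
- exact: Qb.
Qed.

Lemma models_theory V : is_variety V -> forall M, 
  (forall u v, theory V u v -> satisfies M (u, v)) -> V M.
Proof.
case=> E -> M H [u v] Euv; apply: H => N; apply; exact: Euv.
Qed.

Lemma sub_classP V W : is_variety W ->
  sub_class V W <-> (forall u v, theory W u v -> theory V u v).
Proof.
move=> vW; split=> [VW u v uv M VM|H M VM]; first exact/uv/VW.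
by apply: (models_theory vW) => u v /H; apply.
Qed.

Lemma generated_variety K : is_variety (generated K).
Proof.
exists [set e | forall M, K M -> satisfies M e]; apply: funext => M.
apply/propext; split=> [gM|H V vV KV].
  apply: (gM _ _) => [|N KN e]; last exact.
  by exists [set e | forall M, K M -> satisfies M e].
apply: (models_theory vV) => u v uv; apply: H => N KN; apply: uv; exact: KV.
Qed.

Lemma theory_generated K u v :
  theory (generated K) u v <-> (forall M, K M -> satisfies M (u, v)).
Proof.
split=> [H M KM|H M gM]; first by apply: H => V vV KV; apply: KV.
have vK : is_variety (models [set (u, v)]) by exists [set (u, v)].
have: models [set (u, v)] M by apply: gM => // N KN e ->; apply: H.
exact.
Qed.

Lemma theory_var M u v : theory (var M) u v <-> satisfies M (u, v).
Proof. by rewrite theory_generated; split=> [|H N -> //]; apply. Qed.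

Lemma theory_join V W u v :
  theory (join V W) u v <-> theory V u v /\ theory W u v.
Proof.
rewrite theory_generated; split=> [H|[HV HW] M []];
  [split=> M KM | exact: HV | exact: HW].
  by apply: H; left.
by apply: H; right.
Qed.

Lemma trivial_varietyP : is_variety trivial_variety.
Proof.
exists [set id_unit]; apply: funext => M; apply/propext; split=> [H e -> f|H a].
  by rewrite (H (eval f _)) (H (eval f id_unit.2)).
have /(_ (fun _ => a)) := H id_unit erefl.
by rewrite /= eval_cons /eval !big_nil mulg1.
Qed.

Lemma theory_trivial u v : theory trivial_variety u v.
Proof. by move=> M H f; rewrite (H (eval f (u, v).1)) (H (eval f (u, v).2)). Qed.

Definition signature (V : monoid_class) : seq bool :=
  [seq `[< holds (theory V) e >] | e <- test_identities].

Definition table_signature (T : table) : seq bool := map (satb T) test_identities.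

Lemma signature_var M T : wf_table T -> represented M T ->
  signature (var M) = table_signature T.
Proof.
move=> wfT MT; apply/eq_in_map => e eT.
have H : holds (theory (var M)) e <-> satb T e.
  rewrite /holds theory_var -surjective_pairing (represented_sat _ MT).
  exact: satT_test.
by apply/asboolP/idP => /H.
Qed.

Lemma signature_join V W :
  signature (join V W) = [seq p.1 && p.2 | p <- zip (signature V) (signature W)].
Proof.
rewrite /signature; elim: test_identities => //= e s ->; congr (_ :: _).
by apply/asboolP/andP => [/theory_join[? ?]|[/asboolP ? /asboolP ?]];
  [split; apply/asboolP | apply/theory_join].
Qed.

Lemma signature_trivial : signature trivial_variety = nseq 7 true.
Proof.
have H e : `[< holds (theory trivial_variety) e >] = true.
  by apply/asboolP/theory_trivial.
by rewrite /signature /= !H.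
Qed.

(** * Subvarieties of the join and their signatures *)

Definition VX := join VL2 VQ.

Lemma theory_VX u v :
  theory VX u v <-> satT L2_table (u, v) /\ satT Q_table (u, v).
Proof.
rewrite theory_join !theory_var.
by rewrite (represented_sat _ L2_represented) (represented_sat _ Q_represented).
Qed.

Lemma subvariety_subtheory V : subvariety VX V -> subtheory (theory V).
Proof.
case=> vV /(sub_classP _ (generated_variety _)) H.
apply: subtheory_X; first exact: theory_fi.
by move=> [u v] sL sQ; apply: H; apply/theory_VX.
Qed.

Definition sig_le : rel (seq bool) := fun a b => all2 implb a b.

Lemma signature_le V W : 
  sig_le (signature W) (signature V) <->
  (forall e, e \in test_identities -> holds (theory W) e -> holds (theory V) e).
Proof.
rewrite /sig_le /signature; elim: test_identities => [|e s IH] /=; first by split.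
split=> [/andP[/implyP eWV /IH H] e'|H].
  rewrite inE => /orP[/eqP -> /asboolP/eWV/asboolP //|]; exact: H.
apply/andP; split; last by apply/IH => e' es; apply: H; rewrite inE es orbT.
by apply/implyP => /asboolP He; apply/asboolP/H; rewrite ?mem_head.
Qed.

Lemma sub_class_signature V W : subvariety VX V -> subvariety VX W ->
  sub_class V W <-> sig_le (signature W) (signature V).
Proof.
move=> sV sW; rewrite (sub_classP V (proj1 sW)) signature_le.
have tV := subvariety_subtheory sV; have tW := subvariety_subtheory sW.
split=> [H [u v] _|H]; first exact: H.
exact: holds_rel.
Qed.

Lemma sig_le_refl a : sig_le a a.
Proof. by elim: a => //= x a ->; rewrite implybb. Qed.

Lemma signature_inj V W : subvariety VX V -> subvariety VX W ->
  signature V = signature W -> V = W.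
Proof.
move=> sV sW e; apply: funext => M; apply/propext.
split; first by apply: (iffRL (sub_class_signature sV sW)); rewrite e sig_le_refl.
by apply: (iffRL (sub_class_signature sW sV)); rewrite e sig_le_refl.
Qed.

(* In the order in which the theorem lists the varieties. *)
Definition signatures : seq (seq bool) :=
  [:: [:: true;  true;  true;  true;  true;  true;  true];
      [:: false; true;  true;  true;  true;  true;  true];
      [:: false; false; true;  true;  true;  true;  true];
      [:: false; false; false; true;  true;  true;  true];
      [:: false; false; false; false; true;  true;  true];
      [:: false; false; false; true;  false; true;  true];
      [:: false; false; false; false; false; true;  true];
      [:: false; false; false; false; false; false; true];
      [:: false; true;  false; false; true;  true;  false];
      [:: false; false; false; false; true;  true;  false];
      [:: false; false; false; false; false; true;  false];
      [:: false; false; false; false; false; false; false]].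

(** Of the 128 truth patterns the implications collected here leave twelve; the final case analysis
    runs through all of them. *)
Lemma signature_mem E : subtheory E ->
  [seq `[< holds E e >] | e <- test_identities] \in signatures.
Proof.
move=> sE; have imp e e' : (holds E e -> holds E e') ->
    `[< holds E e >] ==> `[< holds E e' >].
  by move=> H; apply/implyP => /asboolP/H/asboolP.
have unit e : holds E id_unit -> holds E e by apply: (unit_rel sE).
have := imp _ _ (unit id_idem); have := imp _ _ (unit id_comm).
have := imp _ _ (idem_last sE).
have := imp _ _ (@comm_first _ sE); have := imp _ _ (@comm_last _ sE).
have := imp _ _ (first_order sE); have := imp _ _ (first_middle sE).
have := imp _ _ (last_middle sE).
have: `[< holds E id_idem >] && `[< holds E id_order >] ==> `[< holds E id_comm >].
  apply/implyP => /andP[/asboolP Hi /asboolP Ho]; apply/asboolP.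
  exact: idem_order_comm.
rewrite /=; do 7!case: `[< _ >] => //.
Qed.

Lemma subvariety_var M h T : represented M T -> divides h Q_table T ->
  subvariety VX (var M).
Proof.
move=> MT hT; split; first exact: generated_variety.
apply/(sub_classP _ (generated_variety _)) => u v /theory_VX[_ sQ].
apply/theory_var/(represented_sat _ MT); exact: (divides_sat hT sQ).
Qed.

Lemma subvariety_join V W : subvariety VX V -> subvariety VX W ->
  subvariety VX (join V W).
Proof.
move=> [_ /(sub_classP _ (generated_variety _)) HV].
move=> [_ /(sub_classP _ (generated_variety _)) HW].
split; first exact: generated_variety.
apply/(sub_classP _ (generated_variety _)) => u v uv.
by apply/theory_join; split; [apply: HV | apply: HW].
Qed.

Lemma subvariety_trivial : subvariety VX trivial_variety.
Proof.
split; first exact: trivial_varietyP.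
apply/(sub_classP _ (generated_variety _)) => u v _; exact: theory_trivial.
Qed.

Lemma subvariety_L2 : subvariety VX VL2.
Proof.
split; first exact: generated_variety.
by apply/(sub_classP _ (generated_variety _)) => u v /theory_join[].
Qed.

Lemma subvariety_Q : subvariety VX VQ.
Proof.
split; first exact: generated_variety.
by apply/(sub_classP _ (generated_variety _)) => u v /theory_join[].
Qed.

(** * The covering relation on signatures *)

Definition sig_lt : rel (seq bool) := fun a b => sig_le a b && ~~ sig_le b a.

(* Larger varieties satisfy fewer identities, hence the reversed order. *)
Definition sig_covers (a b : seq bool) : bool :=
  sig_lt a b && all (fun c => ~~ (sig_lt a c && sig_lt c b)) signatures.

Lemma proper_signature V W : subvariety VX V -> subvariety VX W ->
  proper_sub_class V W <-> sig_lt (signature W) (signature V).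
Proof.
move=> sV sW; rewrite /proper_sub_class (sub_class_signature sV sW).
rewrite (sub_class_signature sW sV).
by split=> [[a /negP b]|/andP[a /negP b]] //; apply/andP.
Qed.

(** The second hypothesis excludes phantom intermediate patterns: a listed signature strictly
    between two others belongs to a subvariety strictly between theirs. *)
Lemma covers_signature (Vs : seq monoid_class) V W :
    (forall V, subvariety VX V <-> List.In V Vs) ->
    (forall s, s \in signatures -> exists2 V, List.In V Vs & signature V = s) ->
    subvariety VX V -> subvariety VX W ->
  covers VX W V <-> sig_covers (signature W) (signature V).
Proof.
move=> VsP onto sV sW; split=> [[_ _ VW mid]|/andP[lt /allP mid]].
  apply/andP; split; first exact/proper_signature.
  apply/allP => s /onto[U /VsP sU <-]; apply/negP => /andP[WU UV].
  by case: (mid U sU); split; apply/proper_signature.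
split=> //; first exact/proper_signature.
move=> U sU [/(proper_signature sV sU) VU /(proper_signature sU sW) UW].
have := mid _ (signature_mem (subvariety_subtheory sU)).
by rewrite -/(signature U) VU UW.
Qed.

Lemma In_mem (A : eqType) (a : A) s : List.In a s <-> a \in s.
Proof.
elim: s => //= b s IH; rewrite inE; split=> [[->|/IH ->]|/orP[/eqP ->|/IH]].
- by rewrite eqxx.
- by rewrite orbT.
- by left.
- by right.
Qed.

Definition signature2 (p : monoid_class * monoid_class) :=
  (signature p.1, signature p.2).

(** Signatures are injective on subvarieties, so membership of a pair of classes becomes a boolean
    test on signatures. *)
Lemma In_signature2 (pairs : seq (monoid_class * monoid_class)) V W :
    (forall U U', List.In (U, U') pairs -> subvariety VX U /\ subvariety VX U') ->
    subvariety VX V -> subvariety VX W ->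
  List.In (W, V) pairs <->
  (signature W, signature V) \in List.map signature2 pairs.
Proof.
move=> sub sV sW; rewrite -In_mem; split=> [/(List.in_map signature2)//|].
case/List.in_map_iff => -[W' V'] [e inWV].
have eW := congr1 fst e; have eV := congr1 snd e; have [sW' sV'] := sub _ _ inWV.
by rewrite -(signature_inj sW' sW eW) -(signature_inj sV' sV eV).
Qed.

Theorem proposition5p5 (x y : nat) (hxy : x <> y) :
  let X := join VL2 VQ in
  let subvarieties :=
    [:: trivial_variety; VM set0; VM [set [:: x]]; VM [set [:: x; y]];
        VI; VJ; VB0; VQ; VL2; join VL2 (VM [set [:: x]]); join VL2 VB0; X] in
  [/\ forall V, subvariety X V <-> List.In V subvarieties,
      List.NoDup subvarieties &
      forall V W, covers X W V <->
        List.In (W, V)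
          [:: (VM set0, trivial_variety);
              (VM [set [:: x]], VM set0);
              (VM [set [:: x; y]], VM [set [:: x]]);
              (VI, VM [set [:: x; y]]);
              (VJ, VM [set [:: x; y]]);
              (VB0, VI);
              (VB0, VJ);
              (VQ, VB0);
              (VL2, VM set0);
              (join VL2 (VM [set [:: x]]), VL2);
              (join VL2 (VM [set [:: x]]), VI);
              (join VL2 VB0, join VL2 (VM [set [:: x]]));
              (join VL2 VB0, VB0);
              (X, join VL2 VB0);
              (X, VQ)]].
Proof.
move=> X subvarieties.
have xy : x != y by apply/eqP.
have sM0 : subvariety X (VM set0).
  (* A triple [(i, j, k)] sends the pair of codes i, j of [Q^1] to the code k. Where j = 0
     throughout, the witness is a submonoid of [Q^1] itself. *)
  exact: (@subvariety_var _ [:: (0, 0, 0); (1, 0, 1)] _ M0_represented).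
have sMx : subvariety X (VM [set [:: x]]).
  exact: (@subvariety_var _ [:: (0, 0, 0); (1, 0, 1); (4, 0, 2)] _ (Mx_represented x)).
have sMxy : subvariety X (VM [set [:: x; y]]).
  (* The letter x comes from (c, 1) and y from (a, c), so xy comes from (ca, c) = (c, c), while yx
     would come from (ac, c), whose first coordinate is zero. All pairs with a zero coordinate are
     collapsed to the zero. *)
  exact: (@subvariety_var _ [:: (0, 0, 0); (4, 0, 2); (2, 4, 3); (4, 4, 4);
    (1, 4, 1); (1, 0, 1); (2, 1, 1); (1, 1, 1); (4, 1, 1)] _ (Mxy_represented xy)).
have sI : subvariety X VI.
  (* The generators a, b of [I] are c, a in [Q]; those of [J] are b, a. *)
  exact: (@subvariety_var _ [:: (0, 0, 0); (1, 0, 1); (4, 0, 2); (2, 0, 3)] _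
    I_represented).
have sJ : subvariety X VJ.
  exact: (@subvariety_var _ [:: (0, 0, 0); (1, 0, 1); (3, 0, 2); (2, 0, 3)] _
    J_represented).
have sB0 : subvariety X VB0.
  (* The generators a, b, c of [B_0] come from (1, a), (a, 1) and (c, b). The product (a, a) of the
     first two is collapsed to the zero, together with the pairs that have a zero coordinate. *)
  exact: (@subvariety_var _ [:: (0, 0, 0); (0, 2, 2); (2, 0, 3); (4, 3, 4);
    (2, 2, 1); (4, 1, 1); (1, 3, 1); (1, 1, 1)] _ B0_represented).
have sT := subvariety_trivial.
have sL2 := subvariety_L2; have sQ := subvariety_Q.
have sLx := subvariety_join sL2 sMx; have sLB := subvariety_join sL2 sB0.
have sX : subvariety X X := subvariety_join sL2 sQ.
have gM0 : signature (VM set0) = nth [::] signatures 1.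
  exact: (signature_var _ M0_represented).
have gMx : signature (VM [set [:: x]]) = nth [::] signatures 2.
  exact: (signature_var _ (Mx_represented x)).
have gMxy : signature (VM [set [:: x; y]]) = nth [::] signatures 3.
  exact: (signature_var _ (Mxy_represented xy)).
have gI : signature VI = nth [::] signatures 4.
  exact: (signature_var _ I_represented).
have gJ : signature VJ = nth [::] signatures 5.
  exact: (signature_var _ J_represented).
have gB0 : signature VB0 = nth [::] signatures 6.
  exact: (signature_var _ B0_represented).
have gQ : signature VQ = nth [::] signatures 7.
  exact: (signature_var _ Q_represented).
have gL2 : signature VL2 = nth [::] signatures 8.
  exact: (signature_var _ L2_represented).
(* Signatures of joins are conjunctions; this places [I^1] below the join of [L_2^1] and M{x}
   without a division witness. *)
have gLx : signature (join VL2 (VM [set [:: x]])) = nth [::] signatures 9.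
  by rewrite signature_join gL2 gMx.
have gLB : signature (join VL2 VB0) = nth [::] signatures 10.
  by rewrite signature_join gL2 gB0.
have gX : signature X = nth [::] signatures 11.
  by rewrite signature_join gL2 gQ.
have sigs : List.map signature subvarieties = signatures.
  by rewrite /= signature_trivial gM0 gMx gMxy gI gJ gB0 gQ gL2 gLx gLB gX.
have all_sub V : List.In V subvarieties -> subvariety X V.
  by move=> /=; do 12?[case=> [<-|]].
have onto s : s \in signatures -> exists2 V, List.In V subvarieties & signature V = s.
  move=> sin; move: sin; rewrite -sigs => /In_mem/List.in_map_iff [V [e inV]].
  by exists V.
have listed V : subvariety X V <-> List.In V subvarieties.
  split=> [sV|]; last exact: all_sub.
  have [U inU e] := onto _ (signature_mem (subvariety_subtheory sV)).
  by rewrite -(signature_inj (all_sub U inU) sV e).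
split=> //.
  apply: (List.NoDup_map_inv signature); rewrite sigs.
  by repeat constructor; move=> /=; do 11?[case=> //].
move=> V W.
have cov := covers_signature listed onto.
set pairs := (X in List.In _ X).
have sub U U' : List.In (U, U') pairs -> subvariety X U /\ subvariety X U'.
  by rewrite /pairs /=; do 15?[case=> [[<- <-]|]] => //; split.
have sig_pairs : List.map signature2 pairs =
    [seq (nth [::] signatures p.1, nth [::] signatures p.2) | p <-
      [:: (1, 0); (2, 1); (3, 2); (4, 3); (5, 3); (6, 4); (6, 5); (7, 6); (8, 1);
          (9, 8); (9, 4); (10, 9); (10, 6); (11, 10); (11, 7)]].
  by rewrite /pairs /signature2 /= signature_trivial gM0 gMx gMxy gI gJ gB0 gQ gL2 gLx
    gLB gX.
(* All 144 ordered pairs of signatures are settled by computation. *)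
have table : all (fun a => all (fun b =>
    sig_covers a b == ((a, b) \in List.map signature2 pairs)) signatures) signatures.
  by rewrite sig_pairs.
have mem_sig U : subvariety X U -> signature U \in signatures.
  by move=> sU; apply: signature_mem (subvariety_subtheory sU).
have coversE : subvariety X V -> subvariety X W ->
    covers X W V <-> List.In (W, V) pairs.
  move=> sV sW; rewrite cov // In_signature2 //.
  by have /allP/(_ _ (mem_sig V sV))/eqP -> := allP table _ (mem_sig W sW).
split=> [c|i]; first by have [sV sW _ _] := c; apply/coversE.
by have [sW sV] := sub _ _ i; apply/coversE.
Qed.
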